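(* Let $a<b$, $0<\alpha<1$, $r>0$, $0<\sigma<1$, and let $u$ be the solution of the time-dependent nonlocal problem $$u_t(x,t)-\int_a^b\frac{u(y,t)-u(x,t)}{|x-y|^\alpha}\,dy=f(x,t),\quad x\in(a,b),\ t>0,$$ with $u(x,0)=u_0(x)$ for $x\in(a,b)$ and $u(x,t)=0$ for $x\in\mathbb{R}\setminus(a,b)$. Suppose that $u$ has the low spatial regularity $$\left|\frac{\partial^\ell}{\partial x^\ell}u(x,t)\right|\le C_0[(x-a)(b-x)]^{\sigma-\ell},\qquad x\in(a,b),\ t\in[0,1],\ \ell=0,1,2,$$ with $u(\cdot,t)\in C^2(a,b)$ and $C_0$ a constant. For integers $N\ge 2$, $M\ge1$, let $u_i^k$ ($1\le i\le 2N-1$, $0\le k\le M$) be the approximation of $u(x_i,t_k)$ computed by the Crank–Nicolson collocation scheme (see context) on the graded mesh $x_0<\dots<x_{2N}$ with grading exponent $r$ and the uniform time mesh $t_k=k/M$. Then there is a constant $C>0$, independent of $N$ and $M$, such that $$\max_{\substack{1\le i\le 2N-1\\ 1\le k\le M}}|u(x_i,t_k)-u_i^k|\le\begin{cases} C\left(N^{-r(1+\sigma-\alpha)}+M^{-2}\right), & \text{if } r(1+\sigma-\alpha)<2,\\ C\left(N^{-r(1+\sigma-\alpha)}\ln N+M^{-2}\right), & \text{if } r(1+\sigma-\alpha)=2,\\ C\left(N^{-2}+M^{-2}\right), & \text{if } r(1+\sigma-\alpha)>2.\end{cases}$$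
   Context: Graded mesh: for $r>0$ and a positive integer $N$, $x_j=a+\frac{b-a}{2}\left(\frac jN\right)^r$ for $j=0,1,\dots,N$ and $x_j=b-\frac{b-a}{2}\left(2-\frac jN\right)^r$ for $j=N+1,\dots,2N$. Hat functions: $\phi_j$, $0\le j\le 2N$, is the continuous function on $[a,b]$ that is affine on each $[x_{k-1},x_k]$ and satisfies $\phi_j(x_k)=\delta_{jk}$. Let $A=(a_{i,k})\in\mathbb{R}^{(2N-1)\times(2N-1)}$ with $a_{i,k}=\int_a^b\frac{\phi_k(x_i)-\phi_k(y)}{|x_i-y|^\alpha}\,dy$ for $i,k=1,\dots,2N-1$. Scheme: with $\tau=1/M$, $t_j=j\tau$, $U^j=(u_1^j,\dots,u_{2N-1}^j)^T$, $F^{j-\frac12}=(f(x_1,t_{j-\frac12}),\dots,f(x_{2N-1},t_{j-\frac12}))^T$, $t_{j-\frac12}=(j-\tfrac12)\tau$, and $u_i^0=u_0(x_i)$, $$\left(I+\tfrac{\tau}{2}A\right)U^j=\left(I-\tfrac{\tau}{2}A\right)U^{j-1}+\tau F^{j-\frac12},\qquad j=1,\dots,M.$$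
   Formalization: The formal theorem also assumes that u is three times differentiable in t on (0,1) with u_tt and u_ttt bounded uniformly on (a,b)×(0,1); without smoothness in time the M^{-2} rate fails, e.g. u=g(t)w(x) with w smooth, compactly supported and g'(t)=|t-1/2|^{1/2}. *)

(* Defs.v *)
From HB Require Import structures.
From mathcomp Require Import all_boot all_order all_algebra.
From mathcomp Require Import all_classical all_reals all_analysis.
Set Implicit Arguments.
Unset Strict Implicit.
Unset Printing Implicit Defensive.
Import Order.TTheory GRing.Theory Num.Theory.
Import numFieldNormedType.Exports.
Local Open Scope classical_set_scope.
Local Open Scope ring_scope.

(* g is of class C^n on ]a, b[. *)
Definition class_Cn (R : realType) (a b : R) (n : nat) (g : R -> R) : Prop :=
  (forall (l : nat) (x : R), (l < n)%N -> a < x < b -> derivable (derive1n l g) x 1) /\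
  (forall x : R, a < x < b -> {for x, continuous (derive1n n g)}).

(* Throughout, space is the first argument and time the second.  The
   singularity of the kernel, |x - x| `^ alpha = 0 `^ alpha = 0, concerns the
   single point y = x, which is Lebesgue-negligible. *)
Definition nonlocal_integrand (R : realType) (alpha : R) (g : R -> R) (x y : R)
  : R := (g y - g x) / `|x - y| `^ alpha.

Record nonlocal_solution (R : realType) (a b alpha : R) (f : R -> R -> R)
    (u0 : R -> R) (u : R -> R -> R) : Prop := NonlocalSolution {
  nonlocal_derivable : forall x t : R, a < x < b -> 0 < t -> derivable (u x) t 1;
  nonlocal_integrable : forall x t : R, a < x < b -> 0 < t ->
    lebesgue_measure.-integrable `[a, b]
      (EFin \o nonlocal_integrand alpha (u^~ t) x);
  nonlocal_equation : forall x t : R, a < x < b -> 0 < t ->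
    derive1 (u x) t
      - \int[lebesgue_measure]_(y in `[a, b])
          nonlocal_integrand alpha (u^~ t) x y = f x t;
  nonlocal_initial : forall x : R, a < x < b -> u x 0 = u0 x;
  nonlocal_initial_cvg : forall x : R, a < x < b -> u x t @[t --> 0^'+] --> u x 0;
  nonlocal_exterior : forall x t : R, ~~ (a < x < b) -> 0 <= t -> u x t = 0
}.

Definition low_spatial_regularity (R : realType) (a b sigma C0 : R)
    (u : R -> R -> R) : Prop :=
  forall t : R, 0 <= t <= 1 ->
    class_Cn a b 2 (u^~ t) /\
    forall (l : nat) (x : R), (l <= 2)%N -> a < x < b ->
      `|derive1n l (u^~ t) x| <= C0 * ((x - a) * (b - x)) `^ (sigma - l%:R).

(* The smoothness in time behind the second order of the Crank-Nicolson
   method: the second and third time derivatives exist and are bounded,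
   uniformly in space.  Spatial regularity at each time does not imply it, and
   without it the M^-2 rate fails (take u = g(t) w(x) with w smooth and
   compactly supported in ]a, b[ and g' only Hoelder continuous). *)
Definition time_regularity (R : realType) (a b C1 : R) (u : R -> R -> R)
  : Prop :=
  forall x t : R, a < x < b -> 0 < t < 1 ->
    [/\ forall l : nat, (l < 3)%N -> derivable (derive1n l (u x)) t 1,
        `|derive1n 2 (u x) t| <= C1 & `|derive1n 3 (u x) t| <= C1].

Definition graded_mesh (R : realType) (a b r : R) (N j : nat) : R :=
  if (j <= N)%N then a + (b - a) / 2 * (j%:R / N%:R) `^ r
  else b - (b - a) / 2 * (2 - j%:R / N%:R) `^ r.

(* The values of phi outside [a, b] are irrelevant and left unspecified. *)
Definition is_hat_function (R : realType) (a b r : R) (N j : nat)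
    (phi : R -> R) : Prop :=
  let x := graded_mesh a b r N in
  [/\ {within `[a, b], continuous phi},
      forall k, (1 <= k <= N.*2)%N -> exists c d : R,
        forall y : R, x k.-1 <= y <= x k -> phi y = c + d * y
    & forall k, (k <= N.*2)%N -> phi (x k) = (j == k)%:R].

(* Rows and columns are indexed by the interior nodes 1, ..., 2N-1; the ordinal
   i : 'I_(2N-1), which starts at 0, stands for node i.+1. *)
Definition collocation_mx (R : realType) (a b alpha r : R) (N : nat)
    (phi : nat -> R -> R) : 'M[R]_(N.*2.-1) :=
  let x := graded_mesh a b r N in
  \matrix_(i, k) \int[lebesgue_measure]_(y in `[a, b])
    ((phi k.+1 (x i.+1) - phi k.+1 y) / `|x i.+1 - y| `^ alpha).

Definition crank_nicolson (R : realType) (a b alpha r : R) (f : R -> R -> R)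
    (u0 : R -> R) (N M : nat) (phi : nat -> R -> R)
    (U : nat -> 'cV[R]_(N.*2.-1)) : Prop :=
  let x := graded_mesh a b r N in
  let tau : R := M%:R^-1 in
  let A := collocation_mx a b alpha r N phi in
  U 0%N = \col_i u0 (x i.+1) /\
  forall j, (1 <= j <= M)%N ->
    (1%:M + (tau / 2) *: A) *m U j =
    (1%:M - (tau / 2) *: A) *m U j.-1
      + tau *: \col_i f (x i.+1) ((j%:R - 2^-1) * tau).

Definition max_error (R : realType) (a b r : R) (u : R -> R -> R) (N M : nat)
    (U : nat -> 'cV[R]_(N.*2.-1)) : R :=
  \big[Num.max/0]_(i < N.*2.-1) \big[Num.max/0]_(1 <= k < M.+1)
    `|u (graded_mesh a b r N i.+1) (k%:R / M%:R) - U k i 0|.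

(* Main.v *)
(** The kernel [|x - y| `^ (- alpha)] is integrable, so the collocation matrix [A]
    is bounded in the maximum norm uniformly in [N]; together with a discrete
    maximum principle for the implicit step this makes the scheme stable, and the
    error is at most [expR K] times the largest local residual.  In time the
    residual is the midpoint rule error.  In space [A] applied to the nodal
    values is the exact operator applied to the piecewise linear interpolant, so
    the residual is the integral of the interpolation error against the kernel.
    On the graded mesh that error is at most [N^-2 (z + delta) `^ beta] with [z]
    the distance to the endpoint, [delta] the first mesh size and [beta <= 0].
    As both factors of the integrand are decreasing functions of a distance, the
    worst case is that the two singularities coincide, and
    [(z + delta) `^ beta * z `^ (- alpha)] is integrated by comparison with explicit
    derivatives; the three rates are the three signs of [beta + 1 - alpha]. *)

Require Import Defs.
From HB Require Import structures.
From mathcomp Require Import all_boot all_order all_algebra.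
From mathcomp Require Import all_classical all_reals all_analysis.
From mathcomp Require Import measurable_realfun zify ring lra.
Set Implicit Arguments.
Unset Strict Implicit.
Unset Printing Implicit Defensive.
Import Order.TTheory GRing.Theory Num.Theory.
Import numFieldNormedType.Exports.
Local Open Scope classical_set_scope.
Local Open Scope ring_scope.

(** * Integrals of singular weights *)

(** The shift by [delta], a multiple of [N^(-r)], lets one weight serve every cell. In an end cell
    the second derivative may be unbounded and the error is only as small as the function itself, of
    order [delta^sigma]. As [N^(-2)] is a multiple of [delta^(2/r)], this is of order
    [N^(-2) * delta^(sigma - 2/r)], the size of the shifted power there. The shift also keeps the
    integral finite whatever the sign of [beta + 1 - alpha]: the product of the two unshifted powers
    need not be integrable once their singularities coincide. The powers of [delta] that the
    integral produces then become powers of [N].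

    The average over two time levels replaces the solution at the midpoint inside the nonlocal
    operator. Since that operator is bounded in the maximum norm, only the size of this averaging
    error matters, not its smoothness in space. Time derivatives are controlled on the open interval
    only, with mere continuity at time 0, so the time estimates combine the mean value theorem on
    closed intervals with derivative bounds at interior points. *)

Lemma ge0_integral_oo_le_primitive (R : realType) (G F : R -> R) (c d B : R) :
  0 <= B ->
  (forall z, c < z < d -> 0 <= G z) ->
  (forall z, c < z < d -> {for z, continuous G}) ->
  (forall z, c < z < d -> is_derive z 1 F (G z)) ->
  (forall y z, c < y -> y <= z -> z < d -> F z - F y <= B) ->
  (\int[lebesgue_measure]_(y in `]c, d[) (G y)%:E <= B%:E)%E.
Proof.
move=> B0 G0 cG dF FB.
have [dc|cd] := leP d c.
  by rewrite set_itv_ge ?integral_set0 ?lee_fin// bnd_simp -leNgt.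
(* [G] may blow up at both ends, so the fundamental theorem is applied on compact intervals
   exhausting the open one, and monotone convergence passes to the limit. *)
pose e (n : nat) : R := (n.+1%:R)^-1.
pose S n := `[c + e n, d - e n]%classic.
have e0 n : 0 < e n by rewrite /e invr_gt0.
have eS m n : (m <= n)%N -> e n <= e m.
  by move=> mn; rewrite /e lef_pV2 ?posrE// ler_nat.
have Ssub n : S n `<=` `]c, d[.
  move=> y; rewrite /S /= !in_itv/= => /andP[h1 h2]; apply/andP; split.
    by rewrite (lt_le_trans _ h1)// ltrDl.
  by rewrite (le_lt_trans h2)// ltrBlDr ltrDl.
have US : \bigcup_n S n = `]c, d[%classic.
  apply/seteqP; split=> [y [n _]|y]; first exact: Ssub.
  rewrite /= in_itv/= => /andP[cy yd].
  pose m := Num.min (y - c) (d - y).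
  have m0 : 0 < m by rewrite lt_min !subr_gt0 cy yd.
  exists (Num.truncn m^-1) => //.
  have em : e (Num.truncn m^-1) <= m.
    rewrite /e -[leRHS]invrK lef_pV2 ?posrE ?invr_gt0//.
    by apply/ltW/truncnS_gt.
  have := em; rewrite le_min => /andP[h1 h2].
  by rewrite /S /= in_itv/=; apply/andP; split; [rewrite -lerBrDl | rewrite lerBrDr -lerBrDl].
have mG : measurable_fun `]c, d[ G.
  apply: open_continuous_measurable_fun => // z.
  by rewrite inE /= in_itv/=; exact: cG.
have Scvg := @ge0_nondecreasing_set_cvg_integral _ (measurableTypeR R) R S (EFin \o G) lebesgue_measure.
rewrite -US.
apply: (cvge_to_le (Scvg _ _ _ _)).
- move=> m n mn; apply/subsetPset => y; rewrite /S /= !in_itv/= => /andP[h1 h2].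
  by have := eS _ _ mn; move: h1 h2; lra.
- by move=> n; exact: measurable_itv.
- move=> n; apply/measurable_EFinP; exact: (measurable_funS _ (Ssub n) mG).
- move=> n x /Ssub; rewrite /= in_itv/= => h; rewrite lee_fin; exact: G0.
apply: nearW => n.
(* For small [n] the compact interval can degenerate to a point or be empty. *)
have [h|h] := leP (d - e n) (c + e n).
  rewrite /S; have [->|hne] := eqVneq (d - e n) (c + e n).
    by rewrite set_itv1 integral_set1 lee_fin.
  by rewrite set_itv_ge ?integral_set0 ?lee_fin// bnd_simp -ltNge lt_neqAle hne.
have In z : c + e n <= z <= d - e n -> c < z < d.
  by move=> hz; have := @Ssub n z; rewrite /S /= !in_itv/=; exact.
have cF : {within S n, continuous F}.
  apply: derivable_within_continuous => z; rewrite in_itv/= => /In /dF dFz.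
  exact: ex_derive.
rewrite /S (@continuous_FTC2 _ G F)//.
- rewrite -EFinB lee_fin; apply: FB.
  + by rewrite ltrDl.
  + exact: ltW.
  + by rewrite ltrBlDr ltrDl.
- apply: continuous_in_subspaceT => z; rewrite inE /= in_itv/= => /In; exact: cG.
- have /(continuous_within_itvP _ h) [_ hl hr] := cF.
  split => // z; rewrite in_itv/= => /andP[h1 h2].
  have hz : c < z < d by apply: In; rewrite !ltW.
  have dFz := dF _ hz; exact: ex_derive.
- move=> z; rewrite in_itv/= => /andP[h1 h2].
  have hz : c < z < d by apply: In; rewrite !ltW.
  by have := dF _ hz => ?; rewrite derive1E derive_val.
Qed.

Lemma measurable_abs_dist (R : realType) (G : R -> R) (x : R) (D : set R) :
  measurable_fun setT G -> measurable_fun D (fun y => G `|x - y|).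
Proof.
move=> mG; apply: (@measurable_funS _ _ _ _ setT) => //.
apply: (measurableT_comp mG).
apply: measurableT_comp => //; exact: measurable_funB.
Qed.

(** Splitting at [x] avoids a change of variables: [- F (x - y)] and [F (y - x)] are primitives on
    the two sides, and each side contributes one [B]. The singular point [y = x] is an end of both
    pieces and is removed as a null set. *)
Lemma ge0_integral_dist_le (R : realType) (G F : R -> R) (a b x B : R) :
  a <= x <= b -> 0 <= B -> measurable_fun setT G ->
  (forall z, 0 <= G z) ->
  (forall z : R, 0 < z -> {for z, continuous G}) ->
  (forall z : R, 0 < z -> is_derive z 1 F (G z)) ->
  (forall y z : R, 0 < y -> y <= z -> z < b - a -> F z - F y <= B) ->
  (\int[lebesgue_measure]_(y in `[a, b]) (G `|x - y|)%:E <= (B + B)%:E)%E.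
Proof.
move=> /andP[ax xb] B0 mG G0 cG dF FB.
have mGx (D : set R) : measurable_fun D (fun y => G `|x - y|) by exact: measurable_abs_dist.
have mGE (D : set R) : measurable_fun D (fun y => (G `|x - y|)%:E).
  by apply/measurable_EFinP; exact: mGx.
have -> : `[a, b]%classic = (`[a, x] `|` `]x, b])%classic.
  apply/seteqP; split=> y; rewrite /= !in_itv/=.
    by move=> /andP[h1 h2]; case: (leP y x) => h; [left|right]; lra.
  by case; lra.
rewrite ge0_integral_setU//=; last 3 first.
- exact: mGE.
- by move=> y _; rewrite lee_fin.
- apply/disj_setPS => y [] /=; rewrite !in_itv/=; lra.
rewrite -integral_itv_bndo_bndc; last exact: mGE.
rewrite -integral_itv_obnd_cbnd; last exact: mGE.
rewrite -integral_itv_bndo_bndc; last exact: mGE.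
rewrite EFinD; apply: leeD.
- under eq_integral => y.
    rewrite inE /= in_itv/= => /andP[ay yx].
    rewrite ger0_norm ?subr_ge0 ?ltW//; over.
  apply: (@ge0_integral_oo_le_primitive _ (fun y => G (x - y)) (fun y => - F (x - y))) => //.
  + move=> z /andP[h1 h2]; apply: (@continuous_comp _ _ _ (fun y => x - y) G).
      by apply: continuousB; [exact: cst_continuous|exact: id].
    by apply: cG; rewrite subr_gt0.
  + move=> z /andP[h1 h2].
    have xz : 0 < x - z by rewrite subr_gt0.
    have dFz := dF _ xz.
    have d1 : is_derive z 1 (fun y : R => x - y) (-1).
      by apply: is_derive_eq; rewrite add0r mul1r.
    have := @is_derive1_comp _ F (fun y : R => x - y) z _ _ dFz d1.
    move=> /is_deriveN; rewrite mulrN1 opprK; exact.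
  + move=> y z h1 h2 h3; rewrite opprK addrC; apply: FB; lra.
- under eq_integral => y.
    rewrite inE /= in_itv/= => /andP[ay yx].
    rewrite distrC ger0_norm ?subr_ge0 ?ltW//; over.
  apply: (@ge0_integral_oo_le_primitive _ (fun y => G (y - x)) (fun y => F (y - x))) => //.
  + move=> z /andP[h1 h2]; apply: (@continuous_comp _ _ _ (fun y => y - x) G).
      by apply: continuousB; [exact: id|exact: cst_continuous].
    by apply: cG; rewrite subr_gt0.
  + move=> z /andP[h1 h2].
    have xz : 0 < z - x by rewrite subr_gt0.
    have dFz := dF _ xz.
    have d1 : is_derive z 1 (fun y : R => y - x) 1.
      by apply: is_derive_eq; rewrite ?oppr0 ?addr0 ?mul1r.
    by have := @is_derive1_comp _ F (fun y : R => y - x) z _ _ dFz d1; rewrite mulr1.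
  + move=> y z h1 h2 h3; apply: FB; lra.
Qed.

Lemma ler_powR_nonpos (R : realType) (r x y : R) :
  r <= 0 -> 0 < x -> x <= y -> y `^ r <= x `^ r.
Proof.
move=> r0 x0 xy; have y0 := lt_le_trans x0 xy.
rewrite -[r]opprK !(powRN _ (- r)) lef_pV2 ?posrE ?powR_gt0//.
by apply: ge0_ler_powR; rewrite ?nnegrE ?oppr_ge0// ltW.
Qed.

Definition shifted_weight (R : realType) (beta alpha delta z : R) : R :=
  (z + delta) `^ beta * (z `^ alpha)^-1.

Lemma shifted_weight_ge0 (R : realType) (beta alpha delta z : R) :
  0 <= shifted_weight beta alpha delta z.
Proof. by rewrite mulr_ge0 ?invr_ge0 ?powR_ge0. Qed.

Lemma measurable_shifted_weight (R : realType) (beta alpha delta : R) :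
  measurable_fun setT (shifted_weight beta alpha delta).
Proof.
apply: measurable_funM.
  apply: (@measurableT_comp _ _ _ _ _ _ (@powR R ^~ beta)).
    exact: measurable_powR.
  exact: measurable_funD.
rewrite (_ : (fun z => _) = (fun z : R => z `^ (- alpha))); last first.
  by apply/funext => z; rewrite powRN.
exact: measurable_powR.
Qed.

(* Away from the origin the first term dominates, near it the second; unlike
   the weight itself, both have elementary primitives. *)
Lemma shifted_weight_le (R : realType) (beta alpha delta z : R) :
  beta <= 0 -> 0 < alpha < 1 -> 0 < delta -> 0 < z ->
  shifted_weight beta alpha delta z <=
    2 * (z + delta) `^ (beta - alpha)
    + 4 * (delta `^ (beta + 1 - alpha)
           * ((z / (z + delta)) `^ (- alpha) * (delta / (z + delta) ^+ 2))).
Proof.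
move=> b0 /andP[a0 a1] d0 z0; rewrite /shifted_weight -powRN.
have v0 : 0 < z + delta by rewrite addr_gt0.
(* If [delta <= z], then [z] is at least half of [z + delta], which costs a factor at most 2 since
   [alpha < 1]. Otherwise [z + delta <= 2 * delta], whose square gives the factor 4. *)
have [dz|zd] := leP delta z.
  rewrite (@le_trans _ _ (2 * (z + delta) `^ (beta - alpha)))//; last first.
    by rewrite lerDl !mulr_ge0 ?powR_ge0 ?invr_ge0 ?exprn_ge0 ?ltW.
  rewrite powRD ?(gt_eqF v0) ?implybT// mulrCA ler_wpM2l ?powR_ge0//.
  have -> : 2 * (z + delta) `^ (- alpha) = 2 * (2^-1) `^ alpha * ((z + delta) / 2) `^ (- alpha).
    have -> : (z + delta) `^ (- alpha) = (2 * ((z + delta) / 2)) `^ (- alpha).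
      by congr powR; lra.
    rewrite powRM ?mulr_ge0 ?ltW// mulrA; congr (_ * _ * _).
    by rewrite -(powR_inv1 (ltW (ltr0n R 2))) -powRrM mulN1r.
  rewrite -[leLHS]mul1r ler_pM ?powR_ge0//; last first.
    by apply: ler_powR_nonpos => //; lra.
  have : 2^-1 `^ alpha >= 2^-1 :> R by apply: ger1_powR; lra.
  lra.
rewrite (@le_trans _ _ (4 * (delta `^ (beta + 1 - alpha) * ((z / (z + delta)) `^ (- alpha) * (delta / (z + delta) ^+ 2)))))//; last first.
  by rewrite lerDr !mulr_ge0 ?powR_ge0 ?invr_ge0 ?exprn_ge0 ?ltW.
have -> : delta `^ (beta + 1 - alpha) = delta `^ beta * delta * delta `^ (- alpha).
  rewrite powRD; last by rewrite (gt_eqF d0) implybT.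
  rewrite powRD; last by rewrite (gt_eqF d0) implybT.
  by rewrite powRr1 ?ltW.
have h1 : (z + delta) `^ beta <= delta `^ beta by apply: ler_powR_nonpos => //; lra.
have h2 : z `^ (- alpha) <= delta `^ (- alpha) * (z / (z + delta)) `^ (- alpha).
  rewrite -powRM; [|exact: ltW|by rewrite ltW// divr_gt0].
  apply: ler_powR_nonpos; [lra|by rewrite !mulr_gt0// invr_gt0|].
  rewrite mulrCA ler_piMr ?(ltW z0)// ler_pdivrMr// mul1r; lra.
have h3 : 1 <= 4 * (delta * (delta / (z + delta) ^+ 2)).
  rewrite !mulrA ler_pdivlMr ?exprn_gt0//; nra.
apply: (@le_trans _ _ (delta `^ beta * (delta `^ (- alpha) * (z / (z + delta)) `^ (- alpha)) * 1)).
  by rewrite mulr1 ler_pM ?powR_ge0.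
rewrite [leRHS](_ : _ = (delta `^ beta * (delta `^ (- alpha) * (z / (z + delta)) `^ (- alpha))) * (4 * (delta * (delta / (z + delta) ^+ 2)))); last by ring.
by rewrite ler_wpM2l// !mulr_ge0 ?powR_ge0.
Qed.

Lemma measurable_riesz (R : realType) (alpha x : R) (D : set R) :
  measurable_fun D (fun y => (`|x - y| `^ alpha)^-1).
Proof.
rewrite (_ : (fun y => _) = (fun y : R => `|x - y| `^ (- alpha))); last first.
  by apply/funext => z; rewrite powRN.
exact: (@measurable_abs_dist R (fun z => z `^ (- alpha)) x D (measurable_powR _)).
Qed.

Lemma is_derive_powR_shift (R : realType) (gamma delta z : R) :
  0 < z + delta ->
  is_derive z 1 (fun y => (y + delta) `^ gamma) (gamma * (z + delta) `^ (gamma - 1)).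
Proof.
move=> v0.
have d1 : is_derive z 1 (fun y : R => y + delta) 1.
  by apply: is_derive_eq; rewrite addr0 ?mul1r.
have dF := is_derive1_powR gamma v0.
by have := @is_derive1_comp _ (fun y => y `^ gamma) (fun y => y + delta) z _ _ dF d1; rewrite mulr1.
Qed.

(** For positive arguments the quotient lies between 0 and 1 and, for [alpha < 1], so does its power
    [1 - alpha]: this primitive has increments at most 1, uniformly in [delta]. *)
Lemma is_derive_powR_ratio (R : realType) (alpha delta z : R) :
  0 < delta -> 0 < z ->
  is_derive z 1 (fun y => (y / (y + delta)) `^ (1 - alpha))
    ((1 - alpha) * ((z / (z + delta)) `^ (- alpha) * (delta / (z + delta) ^+ 2))).
Proof.
move=> d0 z0.
have v0 : 0 < z + delta by rewrite addr_gt0.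
have vn0 : z + delta != 0 by rewrite gt_eqF.
have d1 : is_derive z 1 (fun y : R => y + delta) 1.
  by apply: is_derive_eq; rewrite addr0 ?mul1r.
have d2 : is_derive z 1 (fun y : R => y / (y + delta)) (delta / (z + delta) ^+ 2).
  have dV := @is_deriveV _ (fun y : R => y + delta) z 1 1 vn0 d1.
  have := is_deriveM (is_derive_id z (1 : R)) dV.
  move/is_derive_eq; apply.
  rewrite /GRing.scale /=; field.
  exact: vn0.
have q0 : 0 < z / (z + delta) by rewrite divr_gt0.
have dF := is_derive1_powR (1 - alpha) q0.
have := @is_derive1_comp _ (fun y => y `^ (1 - alpha)) (fun y => y / (y + delta)) z _ _ dF d2.
by rewrite (_ : 1 - alpha - 1 = - alpha) -?mulrA//; ring.
Qed.

(** Only the first term of the majorant depends on the sign of [beta + 1 - alpha]: its primitive is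
    a power or a logarithm, and is therefore left as a parameter [F]. The outer factor 2 counts the
    two sides of [x]. *)
Lemma integral_shifted_weight_dist_le (R : realType) (a b x alpha beta delta B : R)
    (F : R -> R) :
  a <= x <= b -> beta <= 0 -> 0 < alpha < 1 -> 0 < delta -> 0 <= B ->
  (forall z : R, 0 < z -> is_derive z 1 F ((z + delta) `^ (beta - alpha))) ->
  (forall y z : R, 0 < y -> y <= z -> z < b - a -> F z - F y <= B) ->
  (\int[lebesgue_measure]_(y in `[a, b])
     (shifted_weight beta alpha delta `|x - y|)%:E <=
   (2 * (2 * B + 4 / (1 - alpha) * delta `^ (beta + 1 - alpha)))%:E)%E.
Proof.
move=> axb b0 a01 d0 B0 dF FB; have /andP[a0 a1] := a01.
pose P1 z := (z + delta) `^ (beta - alpha).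
(* A form of the second term of the majorant made of powers of [z] and [z + delta], measurable on
   the whole line; it agrees with the quotient form for [z > 0]. *)
pose P2 z := delta * (z `^ (- alpha) * (z + delta) `^ (alpha - 2)).
pose P z := 2 * P1 z + 4 * (delta `^ (beta + 1 - alpha) * P2 z).
pose Q z := 2 * F z + 4 / (1 - alpha) * delta `^ (beta + 1 - alpha) * (z / (z + delta)) `^ (1 - alpha).
have mv r : measurable_fun setT (fun z : R => (z + delta) `^ r).
  apply: (@measurableT_comp _ _ _ _ _ _ (@powR R ^~ r)).
    exact: measurable_powR.
  exact: measurable_funD.
have mP : measurable_fun setT P.
  apply: measurable_funD; first by apply: measurable_funM => //; exact: mv.
  do 3 (apply: measurable_funM => //).
  apply: measurable_funM; last exact: mv.
  exact: measurable_powR.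
have mPx : measurable_fun `[a, b] (fun y => (P `|x - y|)%:E).
  by apply/measurable_EFinP; exact: measurable_abs_dist.
have mSx : measurable_fun `[a, b]
    (fun y => (shifted_weight beta alpha delta `|x - y|)%:E).
  apply/measurable_EFinP; apply: measurable_abs_dist.
  exact: measurable_shifted_weight.
have P0 z : 0 <= P z.
  by rewrite addr_ge0// !mulr_ge0 ?powR_ge0 ?invr_ge0 ?exprn_even_ge0// ltW.
have P2E z : 0 < z -> P2 z = (z / (z + delta)) `^ (- alpha) * (delta / (z + delta) ^+ 2).
  move=> z0; have v0 : 0 < z + delta by rewrite addr_gt0.
  have vi : 0 <= (z + delta)^-1 by rewrite invr_ge0 ltW.
  rewrite /P2 powRM ?(ltW z0)// powRB ?(gt_eqF v0) ?implybT//.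
  rewrite powR_mulrn ?(ltW v0)//.
  rewrite -(powR_inv1 (ltW v0)) -powRrM mulN1r opprK.
  ring.
apply: (@le_trans _ _ (\int[lebesgue_measure]_(y in `[a, b]) (P `|x - y|)%:E)%E).
  apply: ge0_le_integral => //=.
  - by move=> y _; rewrite lee_fin shifted_weight_ge0.
  - move=> y _; rewrite lee_fin.
    (* At [y = x] the weight is 0, by the convention [0^-1 = 0], and nonnegativity of [P]
       suffices. *)
    have [->|xy] := eqVneq y x.
      by rewrite /shifted_weight subrr normr0 powR0 ?gt_eqF// invr0 mulr0.
    have xy0 : 0 < `|x - y| by rewrite normr_gt0 subr_eq0 eq_sym.
    by rewrite /P P2E//; exact: shifted_weight_le.
have hB : 0 <= 2 * B + 4 / (1 - alpha) * delta `^ (beta + 1 - alpha).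
  by rewrite addr_ge0 ?mulr_ge0 ?powR_ge0 ?invr_ge0 ?subr_ge0// ltW.
rewrite (_ : 2 * _ = (2 * B + 4 / (1 - alpha) * delta `^ (beta + 1 - alpha)) + (2 * B + 4 / (1 - alpha) * delta `^ (beta + 1 - alpha))); last by ring.
apply: (@ge0_integral_dist_le _ P Q) => //.
- move=> z z0.
  have v0 : 0 < z + delta by rewrite addr_gt0.
  have c1 : {for z, continuous (fun y : R => y + delta)}.
    by apply: continuousD; [exact: id|exact: cst_continuous].
  have cp (w r : R) : 0 < w -> {for w, continuous (@powR R ^~ r)}.
    move=> w0; apply: differentiable_continuous; apply/derivable1_diffP.
    have := is_derive1_powR r w0 => ?; exact: ex_derive.
  apply: continuousD.
    apply: continuousM; first exact: cst_continuous.
    by apply: (@continuous_comp _ _ _ (fun y : R => y + delta) (@powR R ^~ _)) => //; exact: cp.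
  do 2 (apply: continuousM; first exact: cst_continuous).
  apply: continuousM; first exact: cst_continuous.
  apply: continuousM; first exact: cp.
  by apply: (@continuous_comp _ _ _ (fun y : R => y + delta) (@powR R ^~ _)) => //; exact: cp.
- move=> z z0.
  have d2 := is_derive_powR_ratio alpha d0 z0.
  have := is_deriveD (is_deriveZ 2 (dF z z0)) (is_deriveZ (4 / (1 - alpha) * delta `^ (beta + 1 - alpha)) d2).
  move/is_derive_eq; apply; rewrite /P P2E// /P1 /GRing.scale /=.
  have : 1 - alpha != 0 by lra.
  move: (_ `^ (beta - alpha)) (_ `^ (- alpha)) => u w ?.
  have : z + delta != 0 by lra.
  by move=> ?; field; apply/andP.
- move=> y z y0 yz zb; have := FB y z y0 yz zb.
  have z0 : 0 < z by rewrite (lt_le_trans y0).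
  have h1 : (z / (z + delta)) `^ (1 - alpha) <= 1.
    rewrite [leRHS](_ : 1 = 1 `^ (1 - alpha)); last by rewrite powR1.
    have q0 : 0 <= z / (z + delta) by rewrite ltW// divr_gt0// addr_gt0.
    apply: ge0_ler_powR; rewrite ?nnegrE//; first lra.
    rewrite ler_pdivrMr ?addr_gt0// mul1r; lra.
  have h2 := powR_ge0 (y / (y + delta)) (1 - alpha).
  rewrite /Q.
  have : 0 <= 4 / (1 - alpha) * delta `^ (beta + 1 - alpha).
    by rewrite !mulr_ge0 ?powR_ge0 ?invr_ge0 ?subr_ge0// ltW.
  set K := 4 / _ * _; nra.
Qed.

Definition end_weight (R : realType) (a b beta delta y : R) : R :=
  (y - a + delta) `^ beta + (b - y + delta) `^ beta.

Lemma end_weight_ge0 (R : realType) (a b beta delta y : R) :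
  0 <= end_weight a b beta delta y.
Proof. by rewrite addr_ge0 ?powR_ge0. Qed.

Lemma measurable_end_weight (R : realType) (a b beta delta : R) (D : set R) :
  measurable_fun D (end_weight a b beta delta).
Proof.
apply: measurable_funD;
  apply: (@measurableT_comp _ _ _ _ _ _ (@powR R ^~ beta)) => //;
  try exact: measurable_powR.
- by apply: measurable_funD => //; exact: measurable_funB.
- by apply: measurable_funD => //; exact: measurable_funB.
Qed.

(* The factors are decreasing functions of the distances from [y] to [e] and
   to [x], so their product is largest when both are taken at the smaller one. *)
Lemma mul_riesz_le_shifted_weights (R : realType) (alpha beta delta e x y : R) :
  beta <= 0 -> 0 < alpha -> 0 < delta -> y != e ->
  (`|e - y| + delta) `^ beta * (`|x - y| `^ alpha)^-1 <=
  shifted_weight beta alpha delta `|e - y| + shifted_weight beta alpha delta `|x - y|.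
Proof.
move=> b0 a0 d0 ye.
have ey : 0 < `|e - y| by rewrite normr_gt0 subr_eq0 eq_sym.
have [xy|xy] := leP `|e - y| `|x - y|.
  rewrite (@le_trans _ _ (shifted_weight beta alpha delta `|e - y|)) ?lerDl ?shifted_weight_ge0//.
  rewrite ler_wpM2l ?powR_ge0// -!powRN; apply: ler_powR_nonpos => //; lra.
rewrite (@le_trans _ _ (shifted_weight beta alpha delta `|x - y|)) ?lerDr ?shifted_weight_ge0//.
rewrite ler_wpM2r ?invr_ge0 ?powR_ge0//; apply: ler_powR_nonpos => //.
  by rewrite ltr_wpDl.
by rewrite lerD2r ltW.
Qed.

(** Each endpoint term is dominated by two shifted weights, one centred at that endpoint and one at
    [x]; the four centres [a], [x], [b], [x] give the factor 4. *)
Lemma integral_end_weight_le (R : realType) (a b x alpha beta delta W : R) :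
  a <= x <= b -> beta <= 0 -> 0 < alpha -> 0 < delta ->
  (forall x, a <= x <= b ->
    (\int[lebesgue_measure]_(y in `[a, b])
       (shifted_weight beta alpha delta `|x - y|)%:E <= W%:E)%E) ->
  (\int[lebesgue_measure]_(y in `[a, b])
     (end_weight a b beta delta y * (`|x - y| `^ alpha)^-1)%:E <= (4 * W)%:E)%E.
Proof.
move=> /andP[ax xb] b0 a0 d0 HW.
pose w (e : R) (y : R) := shifted_weight beta alpha delta `|e - y|.
have mw e (D : set R) : measurable_fun D (fun y => (w e y)%:E).
  apply/measurable_EFinP; apply: measurable_abs_dist.
  exact: measurable_shifted_weight.
have mww e f (D : set R) : measurable_fun D (fun y => (w e y)%:E + (w f y)%:E)%E.
  by apply: emeasurable_funD; exact: mw.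
have m4 (D : set R) : measurable_fun D
   (fun y => ((w a y)%:E + (w x y)%:E + ((w b y)%:E + (w x y)%:E))%E).
  by apply: emeasurable_funD; exact: mww.
have w0 e y : (0 <= (w e y)%:E)%E by rewrite lee_fin shifted_weight_ge0.
have mE (D : set R) : measurable_fun D
   (fun y => (end_weight a b beta delta y * (`|x - y| `^ alpha)^-1)%:E).
  apply/measurable_EFinP; apply: measurable_funM.
    exact: measurable_end_weight.
  exact: measurable_riesz.
(* The pointwise domination is available only for [y] different from the endpoint, so both endpoints
   are removed first. *)
rewrite -integral_itv_bndo_bndc; last exact: mE.
rewrite -integral_itv_obnd_cbnd; last exact: mE.
apply: (@le_trans _ _ (\int[lebesgue_measure]_(y in `]a, b[)
   ((w a y)%:E + (w x y)%:E + ((w b y)%:E + (w x y)%:E)))%E).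
  apply: ge0_le_integral => //=.
  - by move=> y _; rewrite lee_fin mulr_ge0 ?end_weight_ge0 ?invr_ge0 ?powR_ge0.
  - exact: mE.
  - exact: m4.
  - move=> y; rewrite in_itv/= => /andP[ay yb].
    rewrite -!EFinD lee_fin /end_weight mulrDl.
    have := @mul_riesz_le_shifted_weights _ alpha beta delta a x y b0 a0 d0.
    have := @mul_riesz_le_shifted_weights _ alpha beta delta b x y b0 a0 d0.
    rewrite (lt_eqF yb) (gt_eqF ay) => /(_ isT) h1 /(_ isT) h2.
    have ea : `|a - y| = y - a by rewrite distrC ger0_norm// subr_ge0 ltW.
    have eb : `|b - y| = b - y by rewrite ger0_norm// subr_ge0 ltW.
    by rewrite /w -[in X in X * _ + _]ea -[in X in _ + X * _]eb lerD.
apply: (@le_trans _ _ (\int[lebesgue_measure]_(y in `[a, b])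
   ((w a y)%:E + (w x y)%:E + ((w b y)%:E + (w x y)%:E)))%E).
  apply: ge0_subset_integral => //=.
  - exact: m4.
  - by move=> y _; rewrite !adde_ge0.
  - exact: subset_itv_oo_cc.
rewrite ge0_integralD//=; last 4 first.
- by move=> y _; rewrite adde_ge0.
- exact: mww.
- by move=> y _; rewrite adde_ge0.
- exact: mww.
rewrite !ge0_integralD//=; try exact: mw.
rewrite (_ : 4 * W = W + W + (W + W)); last by ring.
by rewrite !EFinD; apply: leeD; apply: leeD; apply: HW; lra.
Qed.

(* [N ^- 2] times the size of the integral of the weight on the graded mesh; the
   three cases are the sign of the exponent [beta + 1 - alpha = (p - 2) / r]. *)
Definition rate (R : realType) (p : R) (N : nat) : R :=
  if p < 2 then N%:R `^ (- p)
  else if p == 2 then N%:R `^ (- p) * ln N%:R else N%:R ^- 2.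

Lemma rate_ge0 (R : realType) (p : R) (N : nat) : (0 < N)%N -> 0 <= rate p N.
Proof.
move=> N0; have N1 : 1 <= N%:R :> R by rewrite ler1n.
rewrite /rate; case: ifP => _; first exact: powR_ge0.
by case: ifP => _; rewrite ?mulr_ge0 ?powR_ge0 ?ln_ge0// invr_ge0 exprn_ge0.
Qed.

(* A mesh cell at distance [z] from the endpoint has length of order
   [z `^ (1 - 1/r) / N], so its interpolation error is [N^-2] times
   [z `^ (sigma - 2/r)]; the exponent is capped at 0 to get a decreasing weight. *)
Definition graded_exponent (R : realType) (r sigma : R) : R :=
  Num.min 0 (sigma - 2 / r).

(** The primitive [(z + delta)^g / g] with [g < 0] increases towards 0, so its increments are at
    most minus its value at [z = 0]: the singular end dominates. *)
Lemma integral_shifted_weight_neg (R : realType) (a b x alpha beta delta : R) :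
  a <= x <= b -> beta <= 0 -> 0 < alpha < 1 -> 0 < delta -> beta + 1 - alpha < 0 ->
  (\int[lebesgue_measure]_(y in `[a, b])
     (shifted_weight beta alpha delta `|x - y|)%:E <=
   (2 * (2 * (delta `^ (beta + 1 - alpha) / - (beta + 1 - alpha))
      + 4 / (1 - alpha) * delta `^ (beta + 1 - alpha)))%:E)%E.
Proof.
move=> axb b0 a01 d0 g0; set g := beta + 1 - alpha in g0 *.
apply: (@integral_shifted_weight_dist_le _ _ _ _ _ _ _ _ (fun z => g^-1 * (z + delta) `^ g)) => //.
- by rewrite divr_ge0 ?powR_ge0// oppr_ge0 ltW.
- move=> z z0; have v0 : 0 < z + delta by rewrite addr_gt0.
  have := is_deriveZ g^-1 (is_derive_powR_shift g v0); move/is_derive_eq; apply.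
  rewrite /GRing.scale /= mulrA mulVf ?lt_eqF// mul1r; congr powR; rewrite /g; ring.
- move=> y z y0 yz zb.
  have h1 := powR_ge0 (z + delta) g.
  have h2 : (y + delta) `^ g <= delta `^ g by apply: ler_powR_nonpos => //; [exact: ltW|rewrite lerDr ltW].
  have i0 : 0 < (- g)^-1 by rewrite invr_gt0 oppr_gt0.
  rewrite (_ : g^-1 = - (- g)^-1); last by rewrite invrN opprK.
  by set i := (- g)^-1 in i0 *; nra.
Qed.

Lemma integral_shifted_weight_zero (R : realType) (a b x alpha beta delta : R) :
  a <= x <= b -> beta <= 0 -> 0 < alpha < 1 -> 0 < delta -> beta + 1 - alpha = 0 ->
  (\int[lebesgue_measure]_(y in `[a, b])
     (shifted_weight beta alpha delta `|x - y|)%:E <=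
   (2 * (2 * ln ((b - a + delta) / delta) + 4 / (1 - alpha)))%:E)%E.
Proof.
move=> axb b0 a01 d0 g0.
have ba : 0 <= b - a by lra.
have -> : 4 / (1 - alpha) = 4 / (1 - alpha) * delta `^ (beta + 1 - alpha).
  by rewrite g0 powRr0 mulr1.
apply: (@integral_shifted_weight_dist_le _ _ _ _ _ _ _ _ (fun z => ln (z + delta))) => //.
- by apply: ln_ge0; rewrite ler_pdivlMr// mul1r lerDr.
- move=> z z0; have v0 : 0 < z + delta by rewrite addr_gt0.
  have d1 : is_derive z 1 (fun y : R => y + delta) 1.
    by apply: is_derive_eq; rewrite addr0 ?mul1r.
  have := @is_derive1_comp _ (@ln R) (fun y => y + delta) z _ _ (is_derive1_ln v0) d1.
  move/is_derive_eq; apply.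
  by rewrite mulr1 (_ : beta - alpha = -1) ?powR_inv1 ?ltW//; lra.
- move=> y z y0 yz zb; rewrite ln_div ?posrE; [|lra|lra].
  by apply: lerB; rewrite ler_ln ?posrE; lra.
Qed.

(** Here the primitive is nonnegative and increasing, so its value at the far end [z = b - a] bounds
    its increments, and the bound stays finite as [delta] tends to 0. *)
Lemma integral_shifted_weight_pos (R : realType) (a b x alpha beta delta : R) :
  a <= x <= b -> beta <= 0 -> 0 < alpha < 1 -> 0 < delta -> 0 < beta + 1 - alpha ->
  (\int[lebesgue_measure]_(y in `[a, b])
     (shifted_weight beta alpha delta `|x - y|)%:E <=
   (2 * (2 * ((b - a + delta) `^ (beta + 1 - alpha) / (beta + 1 - alpha))
      + 4 / (1 - alpha) * delta `^ (beta + 1 - alpha)))%:E)%E.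
Proof.
move=> axb b0 a01 d0 g0; set g := beta + 1 - alpha in g0 *.
apply: (@integral_shifted_weight_dist_le _ _ _ _ _ _ _ _ (fun z => g^-1 * (z + delta) `^ g)) => //.
- by rewrite divr_ge0 ?powR_ge0// ltW.
- move=> z z0; have v0 : 0 < z + delta by rewrite addr_gt0.
  have := is_deriveZ g^-1 (is_derive_powR_shift g v0); move/is_derive_eq; apply.
  rewrite /GRing.scale /= mulrA mulVf ?gt_eqF// mul1r; congr powR; rewrite /g; ring.
- move=> y z y0 yz zb.
  have h1 := powR_ge0 (y + delta) g.
  have h2 : (z + delta) `^ g <= (b - a + delta) `^ g.
    by apply: ge0_ler_powR; rewrite ?nnegrE; lra.
  rewrite -mulrBr mulrC ler_pM2r ?invr_gt0//; lra.
Qed.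

Lemma integral_riesz_le (R : realType) (a b alpha : R) :
  a < b -> 0 < alpha < 1 ->
  exists2 K : R, 0 < K & forall x, a <= x <= b ->
    (\int[lebesgue_measure]_(y in `[a, b]) ((`|x - y| `^ alpha)^-1)%:E <= K%:E)%E.
Proof.
move=> ab a01; have /andP[a0 a1] := a01.
(* The bare kernel is the shifted weight with [beta = 0]; [delta = 1] is an arbitrary choice. *)
exists (2 * (2 * ((b - a + 1) `^ (0 + 1 - alpha) / (0 + 1 - alpha))
      + 4 / (1 - alpha) * 1 `^ (0 + 1 - alpha))).
  rewrite powR1 mulr1 mulr_gt0// addr_gt0 ?mulr_gt0 ?invr_gt0 ?powR_gt0//; lra.
move=> x axb.
have g0 : 0 < 0 + 1 - alpha by lra.
have := integral_shifted_weight_pos axb (lexx 0) a01 ltr01 g0.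
by under eq_integral do rewrite /shifted_weight powRr0 mul1r.
Qed.

Lemma graded_delta_powR (R : realType) (L r g : R) (N : nat) :
  0 < L -> (L * N%:R `^ (- r)) `^ g = L `^ g * N%:R `^ (- (r * g)).
Proof. by move=> L0; rewrite powRM ?powR_ge0 ?ltW// -powRrM mulNr. Qed.

(** For [p <= 2] the cap on the exponent is inactive, because [sigma - 2 / r <= alpha - 1 < 0], and
    [delta^(beta + 1 - alpha)] is a multiple of [N^(2 - p)]. For [p > 2] the cap may be active, but
    [beta + 1 - alpha] is positive either way; with [delta <= L] the integral is then bounded
    uniformly in [N]. *)
Lemma integral_end_weight_graded_le (R : realType) (a b alpha r sigma : R) :
  a < b -> 0 < alpha < 1 -> 0 < r -> 0 < sigma ->
  exists2 K : R, 0 < K & forall (N : nat) (x : R), (2 <= N)%N -> a <= x <= b ->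
    (\int[lebesgue_measure]_(y in `[a, b])
      (end_weight a b (graded_exponent r sigma) ((b - a) / 2 * N%:R `^ (- r)) y
        * (`|x - y| `^ alpha)^-1)%:E
     <= (K * (N%:R ^+ 2 * rate (r * (1 + sigma - alpha)) N))%:E)%E.
Proof.
move=> ab a01 r0 s0; have /andP[a0 a1] := a01.
set p := r * _; set L := (b - a) / 2; set beta := graded_exponent r sigma.
have L0 : 0 < L by rewrite divr_gt0// subr_gt0.
have b0 : beta <= 0 by rewrite /beta /graded_exponent ge_min lexx.
have a1' : 0 < 4 / (1 - alpha) by rewrite divr_gt0// subr_gt0.
have rg : r * (sigma - 2 / r + 1 - alpha) = p - 2.
  by rewrite /p; field; rewrite gt_eqF.
have NR (N : nat) : (2 <= N)%N -> 2 <= N%:R :> R by rewrite (ler_nat _ 2).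
have d0 (N : nat) : (2 <= N)%N -> 0 < L * N%:R `^ (- r).
  by move=> /NR N2; rewrite mulr_gt0// powR_gt0; lra.
have dL (N : nat) : (2 <= N)%N -> L * N%:R `^ (- r) <= L.
  move=> /NR N2; rewrite ler_piMr ?(ltW L0)//.
  rewrite [leRHS](_ : 1 = 1 `^ (- r)); last by rewrite powR1.
  by apply: ler_powR_nonpos; lra.
have main K : (forall (N : nat) x, (2 <= N)%N -> a <= x <= b ->
    (\int[lebesgue_measure]_(y in `[a, b])
      (shifted_weight beta alpha (L * N%:R `^ (- r)) `|x - y|)%:E
     <= (K * (N%:R ^+ 2 * rate p N))%:E)%E) -> 0 < K ->
  exists2 K : R, 0 < K & forall (N : nat) (x : R), (2 <= N)%N -> a <= x <= b ->
    (\int[lebesgue_measure]_(y in `[a, b])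
      (end_weight a b beta (L * N%:R `^ (- r)) y
        * (`|x - y| `^ alpha)^-1)%:E
     <= (K * (N%:R ^+ 2 * rate p N))%:E)%E.
  move=> H K0; exists (4 * K); first by rewrite mulr_gt0.
  move=> N x N2 axb; rewrite -mulrA; apply: integral_end_weight_le => //.
    exact: d0.
  by move=> y; exact: H.
have [p2|p2|p2] := ltgtP p 2.
- have g0 : sigma - 2 / r + 1 - alpha < 0.
    by rewrite -(pmulr_rlt0 _ r0) rg subr_lt0.
  have bE : beta = sigma - 2 / r by rewrite /beta /graded_exponent min_r//; lra.
  rewrite -bE in g0 rg.
  apply: (main (2 * (2 * (L `^ (beta + 1 - alpha) / - (beta + 1 - alpha))
      + 4 / (1 - alpha) * L `^ (beta + 1 - alpha)))); last first.
    rewrite mulr_gt0// addr_gt0// mulr_gt0 ?powR_gt0// divr_gt0 ?powR_gt0 ?oppr_gt0//.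
  move=> N x N2 axb; have N2' := NR _ N2.
  apply: (le_trans (integral_shifted_weight_neg axb b0 a01 (d0 _ N2) g0)).
  rewrite graded_delta_powR// rg /rate p2 lee_fin.
  have -> : N%:R ^+ 2 * N%:R `^ (- p) = N%:R `^ (- (p - 2)) :> R.
    have N0 : N%:R != 0 :> R by rewrite gt_eqF//; lra.
    by rewrite -(powR_mulrn 2) ?ler0n// -powRD ?N0 ?implybT// opprB.
  set A := L `^ _; set B := N%:R `^ _; rewrite le_eqVlt; apply/orP; left; apply/eqP; ring.
- have g0 : 0 < beta + 1 - alpha.
    rewrite /beta /graded_exponent; have [h|h] := leP 0 (sigma - 2 / r); first lra.
    by rewrite -(pmulr_rgt0 _ r0) rg subr_gt0.
  apply: (main (2 * (2 * ((b - a + L) `^ (beta + 1 - alpha) / (beta + 1 - alpha))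
      + 4 / (1 - alpha) * L `^ (beta + 1 - alpha)))); last first.
    rewrite mulr_gt0// addr_gt0// mulr_gt0 ?powR_gt0// divr_gt0 ?powR_gt0//; lra.
  move=> N x N2 axb; have N2' := NR _ N2; have dN := dL _ N2; have dN0 := d0 _ N2.
  apply: (le_trans (integral_shifted_weight_pos axb b0 a01 (d0 _ N2) g0)).
  rewrite lee_fin /rate ltNge (ltW p2) /= (gt_eqF p2) mulfV ?expf_neq0 ?gt_eqF//; last lra.
  rewrite mulr1 ler_pM2l// lerD//.
    rewrite ler_pM2l// ler_pM2r ?invr_gt0//; apply: ge0_ler_powR; rewrite ?nnegrE; lra.
  rewrite ler_pM2l//; apply: ge0_ler_powR; rewrite ?nnegrE; lra.
- have g0 : sigma - 2 / r + 1 - alpha = 0.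
    have rn0 : r != 0 by rewrite gt_eqF.
    by apply: (mulfI rn0); rewrite rg p2 subrr mulr0.
  have bE : beta = sigma - 2 / r by rewrite /beta /graded_exponent min_r//; lra.
  rewrite -bE in g0.
  have l2 : 0 < ln 2 :> R by rewrite ln_gt0// ltr1n.
  (* The quotient inside the logarithm is [1 + 2 * N^r <= 4 * N^r], with logarithm at most
     [(2 + r) * ln N] because [N >= 2]. Likewise [ln N / ln 2 >= 1] absorbs the constant term. *)
  apply: (main (2 * (2 * (2 + r) + 4 / (1 - alpha) / ln 2))); last first.
    by rewrite mulr_gt0// addr_gt0// ?divr_gt0//; lra.
  move=> N x N2 axb; have N2' := NR _ N2; have dN0 := d0 _ N2.
  apply: (le_trans (integral_shifted_weight_zero axb b0 a01 (d0 _ N2) g0)).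
  have N0 : 0 < N%:R :> R by lra.
  have lN : ln 2 <= ln N%:R :> R by rewrite ler_ln ?posrE; lra.
  rewrite lee_fin /rate p2 ltxx eqxx.
  have -> : N%:R ^+ 2 * (N%:R `^ (- 2) * ln N%:R) = ln N%:R :> R.
    by rewrite powR_invn ?ler0n// mulrA mulfV ?expf_neq0 ?gt_eqF// mul1r.
  have lnle : ln ((b - a + L * N%:R `^ (- r)) / (L * N%:R `^ (- r)))
      <= (2 + r) * ln N%:R.
    have -> : b - a = 2 * L by rewrite /L; field.
    have Nr0 : 0 < N%:R `^ r :> R by rewrite powR_gt0.
    rewrite (_ : (_ + _) / _ = 1 + 2 * N%:R `^ r); last first.
      by rewrite powRN; field; rewrite !gt_eqF.
    have Nr1 : 1 <= N%:R `^ r :> R.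
      rewrite [leLHS](_ : 1 = 1 `^ r); last by rewrite powR1.
      by apply: ge0_ler_powR; rewrite ?nnegrE; lra.
    apply: (@le_trans _ _ (ln (2 ^+ 2 * N%:R `^ r))).
      by rewrite ler_ln ?posrE; lra.
    rewrite lnM ?posrE ?powR_gt0 ?exprn_gt0// ln_powR lnXn//; lra.
  set Z := ln (_ / _) in lnle *.
  have h1 : 1 <= ln N%:R / ln 2 :> R by rewrite ler_pdivlMr// mul1r.
  have h2 : 4 / (1 - alpha) <= 4 / (1 - alpha) * (ln N%:R / ln 2) by rewrite ler_peMr// ltW.
  set A := 4 / (1 - alpha) in a1' h2 *.
  rewrite (_ : 2 * (2 * (2 + r) + A / ln 2) * ln N%:R
     = 2 * (2 * ((2 + r) * ln N%:R) + A * (ln N%:R / ln 2))); last by ring.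
  lra.
Qed.

(** * Interpolation on the graded mesh *)

(** For [j >= 2] one has [(j - 1) / N >= (j / N) / 2], so powers at any two points of a cell are
    comparable; the absolute value in the constant handles both signs of the exponent. *)
Lemma powR_half_le (R : realType) (s q t : R) :
  0 < q -> q / 2 <= t <= q -> t `^ s <= 2 `^ `|s| * q `^ s.
Proof.
move=> q0 /andP[qt tq]; have t0 : 0 < t by lra.
have [s0|s0] := leP 0 s.
  apply: (@le_trans _ _ (q `^ s)); first by apply: ge0_ler_powR; rewrite ?nnegrE//; lra.
  rewrite ler_peMl ?powR_ge0//.
  rewrite [leLHS](_ : 1 = 1 `^ `|s|); last by rewrite powR1.
  by apply: ge0_ler_powR; rewrite ?nnegrE// ?ler1n//; lra.
apply: (@le_trans _ _ ((q / 2) `^ s)); first by apply: ler_powR_nonpos => //; lra.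
rewrite (_ : q / 2 = 2^-1 * q); last by rewrite mulrC.
rewrite powRM ?(ltW q0) ?invr_ge0//.
rewrite ler_wpM2r ?powR_ge0// -(powR_inv1 (ltW (ltr0n R 2))) -powRrM.
apply: ler_powR; first by rewrite ler1n.
by rewrite ltr0_norm// mulN1r.
Qed.

Section GradedEstimates.
Context {R : realType}.
Variables (L r sigma : R) (L0 : 0 < L) (r0 : 0 < r).

Let beta := graded_exponent r sigma.

Lemma graded_exponent_le0 : beta <= 0.
Proof. by rewrite /beta /graded_exponent ge_min lexx. Qed.

(** With [q = j / N >= 1 / N] both [z] and the shift are at most [L * q^r], and [beta <= 0] reverses
    the comparison. Then [r * beta <= r * sigma - 2] and [q <= 1] give the stated power of [q],
    whether or not the cap is active. *)
Lemma end_weight_lower (N j : nat) (z : R) : (1 <= j <= N)%N ->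
  0 <= z <= L * (j%:R / N%:R) `^ r ->
  (2 * L) `^ beta * (j%:R / N%:R) `^ (r * sigma - 2) <=
  (z + L * N%:R `^ (- r)) `^ beta.
Proof.
move=> /andP[j1 jN] /andP[z0 zj].
have j1' : 1 <= j%:R :> R by rewrite ler1n.
have jN' : j%:R <= N%:R :> R by rewrite ler_nat.
have N0 : 0 < N%:R :> R by lra.
set q := j%:R / N%:R in zj *.
have q0 : 0 < q by rewrite divr_gt0//; lra.
have q1 : q <= 1 by rewrite ler_pdivrMr// mul1r.
have b0 := graded_exponent_le0.
have Nq : N%:R `^ (- r) <= q `^ r.
  rewrite -mulN1r powRrM powR_inv1 ?(ltW N0)//.
  apply: ge0_ler_powR; rewrite ?nnegrE ?invr_ge0 ?(ltW r0) ?(ltW N0) ?(ltW q0)//.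
  by rewrite /q -[leLHS]mul1r ler_pM2r ?invr_gt0.
have rb : r * beta <= r * sigma - 2.
  have -> : r * sigma - 2 = r * (sigma - 2 / r) by field; rewrite gt_eqF.
  by rewrite ler_pM2l// /beta /graded_exponent ge_min lexx orbT.
have := powR_gt0 (- r) N0; move: (N%:R `^ (- r)) Nq => t tq t0.
apply: (@le_trans _ _ ((2 * L * q `^ r) `^ beta)); last first.
  have Lt : L * t <= L * q `^ r by rewrite ler_pM2l.
  have Lt0 : 0 < L * t by rewrite mulr_gt0.
  by apply: ler_powR_nonpos => //; lra.
have L20 : 0 <= 2 * L by rewrite mulr_ge0// ltW.
rewrite (powRM _ L20 (powR_ge0 q r)).
rewrite ler_wpM2l ?powR_ge0// -powRrM; apply: ger_powR => //.
by rewrite q0 q1.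
Qed.

(** The case [q = 1 / N], where [q^(r * sigma) = N^(-2) * q^(r * sigma - 2)]: the size of the
    function over an end cell is already within the interpolation bound. *)
Lemma graded_first_cell (N : nat) (z : R) : (1 <= N)%N ->
  0 <= z <= L * (1%:R / N%:R) `^ r ->
  (L * (1%:R / N%:R) `^ r) `^ sigma <=
  L `^ sigma / (2 * L) `^ beta * N%:R ^- 2 * (z + L * N%:R `^ (- r)) `^ beta.
Proof.
move=> N1 zN.
have := @end_weight_lower N 1 z N1 zN.
have N0 : 0 < N%:R :> R by rewrite ltr0n.
have c0 : 0 < (2 * L) `^ beta by apply: powR_gt0; rewrite mulr_gt0.
set W := (z + _) `^ beta; rewrite mul1r => h.
rewrite powRM ?powR_ge0 ?(ltW L0)// -powRrM -!mulrA ler_wpM2l ?powR_ge0//.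
have -> : N%:R^-1 `^ (r * sigma) = N%:R ^- 2 * N%:R^-1 `^ (r * sigma - 2) :> R.
  rewrite -exprVn -powR_mulrn ?invr_ge0 ?ler0n// -powRD; first by congr powR; lra.
  by rewrite invr_eq0 (gt_eqF N0) implybT.
rewrite mulrCA ler_wpM2l ?invr_ge0 ?exprn_ge0 ?ler0n//.
by rewrite [leRHS]mulrC ler_pdivlMr// [leLHS]mulrC.
Qed.

(** The factors come, in order, from the squared cell length, from the second derivative at the cell
    end nearest the endpoint, and from the lower bound on the weight. *)
Definition graded_cell_const : R :=
  (L * r * 2 `^ `|r - 1|) ^+ 2 * (L `^ (sigma - 2) * 2 `^ `|r * (sigma - 2)|)
  / (2 * L) `^ beta.

Lemma graded_cell_const_ge0 : 0 <= graded_cell_const.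
Proof.
apply: divr_ge0 (powR_ge0 _ _); apply: mulr_ge0; first exact: sqr_ge0.
exact: mulr_ge0 (powR_ge0 _ _) (powR_ge0 _ _).
Qed.

(** By the mean value theorem the cell length is of order [q^(r - 1) / N]. Its square times
    [q^(r * (sigma - 2))] is [N^(-2) * q^(r * sigma - 2)], exactly the power in the lower bound for
    the weight. *)
Lemma graded_cell (N j : nat) (z : R) : (2 <= j <= N)%N ->
  0 <= z <= L * (j%:R / N%:R) `^ r ->
  (L * (j%:R / N%:R) `^ r - L * (j.-1%:R / N%:R) `^ r) ^+ 2
    * (L * (j.-1%:R / N%:R) `^ r) `^ (sigma - 2) <=
  graded_cell_const * N%:R ^- 2 * (z + L * N%:R `^ (- r)) `^ beta.
Proof.
move=> /andP[j2 jN] zN.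
have j1 : (1 <= j <= N)%N by rewrite jN andbT (leq_trans _ j2).
have := @end_weight_lower N j z j1 zN.
have j2' : 2 <= j%:R :> R by rewrite ler_nat.
have jN' : j%:R <= N%:R :> R by rewrite ler_nat.
have jp : j.-1%:R = j%:R - 1 :> R by rewrite -subn1 natrB// (leq_trans _ j2).
have N0 : 0 < N%:R :> R by lra.
have c0 : 0 < (2 * L) `^ beta by apply: powR_gt0; rewrite mulr_gt0.
set W := (z + _) `^ beta; rewrite jp.
set q := j%:R / N%:R; set q' := (j%:R - 1) / N%:R => h.
have q0 : 0 < q by rewrite divr_gt0//; lra.
have qq : q - q' = N%:R^-1 by rewrite /q /q'; field; rewrite gt_eqF.
have q'q : q / 2 <= q' by rewrite /q /q' mulrAC ler_pM2r ?invr_gt0//; lra.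
have Ni : 0 < N%:R^-1 :> R by rewrite invr_gt0.
have [xi xiq dE] : exists2 xi, xi \in `]q', q[ & q `^ r - q' `^ r = r * xi `^ (r - 1) * (q - q').
  apply: (@MVT _ (fun t => t `^ r) (fun t => r * t `^ (r - 1))); first lra.
    by move=> t; rewrite in_itv/= => /andP[h1 h2]; apply: is_derive1_powR; lra.
  apply: derivable_within_continuous => t; rewrite in_itv/= => /andP[h1 h2].
  have t0 : 0 < t by lra.
  by have := is_derive1_powR r t0 => ?; exact: ex_derive.
have xiB : xi `^ (r - 1) <= 2 `^ `|r - 1| * q `^ (r - 1).
  by apply: powR_half_le => //; move: xiq; rewrite in_itv/= => /andP[]; lra.
have hB : q' `^ (r * (sigma - 2)) <= 2 `^ `|r * (sigma - 2)| * q `^ (r * (sigma - 2)).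
  by apply: powR_half_le => //; lra.
have -> : L * q `^ r - L * q' `^ r = L * r * xi `^ (r - 1) * N%:R^-1.
  by rewrite -mulrBr dE qq; ring.
rewrite powRM ?powR_ge0 ?(ltW L0)// -powRrM.
have qE : (q `^ (r - 1)) ^+ 2 * q `^ (r * (sigma - 2)) = q `^ (r * sigma - 2).
  rewrite -powR_mulrn ?powR_ge0// -powRrM -powRD ?(gt_eqF q0) ?implybT//.
  by congr powR; ring.
apply: (@le_trans _ _ ((L * r * (2 `^ `|r - 1| * q `^ (r - 1)) * N%:R^-1) ^+ 2
   * (L `^ (sigma - 2) * (2 `^ `|r * (sigma - 2)| * q `^ (r * (sigma - 2)))))).
  have Lr0 : 0 <= L * r by rewrite mulr_ge0 // ltW.
  have X0 : 0 <= L * r * xi `^ (r - 1) * N%:R^-1.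
    by rewrite mulr_ge0 ?(ltW Ni)// mulr_ge0 ?powR_ge0.
  have XX : L * r * xi `^ (r - 1) * N%:R^-1 <=
            L * r * (2 `^ `|r - 1| * q `^ (r - 1)) * N%:R^-1.
    by rewrite ler_wpM2r ?(ltW Ni)// ler_wpM2l.
  apply: ler_pM; [exact: exprn_ge0|by rewrite mulr_ge0 ?powR_ge0| |].
    by rewrite lerXn2r ?nnegrE// (le_trans X0).
  by rewrite ler_wpM2l ?powR_ge0.
rewrite [leLHS](_ : _ = (L * r * 2 `^ `|r - 1|) ^+ 2 * (L `^ (sigma - 2) * 2 `^ `|r * (sigma - 2)|) * N%:R ^- 2 * ((q `^ (r - 1)) ^+ 2 * q `^ (r * (sigma - 2)))); last first.
  rewrite -exprVn; set Y := N%:R^-1; ring.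
rewrite qE /graded_cell_const.
set A := (_ * _) ^+ 2 * _.
have A0 : 0 <= A by rewrite /A mulr_ge0 ?sqr_ge0// mulr_ge0 ?powR_ge0.
clearbody A; rewrite -!mulrA ler_wpM2l//.
rewrite [leRHS]mulrCA ler_wpM2l ?invr_ge0 ?exprn_ge0 ?ler0n//.
by rewrite [leRHS]mulrC ler_pdivlMr// [leLHS]mulrC.
Qed.

End GradedEstimates.

Lemma affine_norm_le (R : realType) (c e p q m y : R) :
  `|c + e * p| <= m -> `|c + e * q| <= m -> p <= y <= q -> `|c + e * y| <= m.
Proof.
rewrite !ler_norml => /andP[h1 h2] /andP[h3 h4] /andP[py yq].
by have [e0|e0] := leP 0 e; apply/andP; split; nra.
Qed.

Lemma mean_value_norm_le (R : realType) (g : R -> R) (p q K : R) :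
  (forall z, p <= z <= q -> derivable g z 1) ->
  (forall z, p <= z <= q -> `|derive1 g z| <= K) ->
  forall y z, p <= y <= q -> p <= z <= q -> `|g y - g z| <= K * `|y - z|.
Proof.
move=> dg gK y z; wlog yz : y z / y <= z.
  move=> H hy hz; have [yz|/ltW zy] := leP y z; first exact: H.
  by rewrite distrC (distrC y); exact: H.
move=> /andP[py yq] /andP[pz zq].
have In t : y <= t <= z -> p <= t <= q by lra.
have [||t + E] := @MVT_segment R g (derive1 g) y z yz.
- move=> t; rewrite in_itv/= => /andP[h1 h2]; rewrite derive1E; apply/derivableP.
  by apply/dg/In; lra.
- by apply: derivable_within_continuous => t; rewrite in_itv/= => /In /dg.
rewrite in_itv/= => /In tpq.
rewrite distrC (distrC y) E normrM ler_wpM2r//; exact: gK.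
Qed.

(** The slope [e] is a value of [w'], and so is the difference quotient of [w] between [p] and [y].
    The error is their difference times [y - p], and [w'] is Lipschitz with constant [K]. *)
Lemma affine_interpolation_error (R : realType) (w : R -> R) (c e p q K y : R) :
  p < q -> (forall z, p <= z <= q -> derivable w z 1) ->
  (forall z, p <= z <= q -> derivable (derive1 w) z 1) ->
  (forall z, p <= z <= q -> `|derive1n 2 w z| <= K) ->
  c + e * p = w p -> c + e * q = w q -> p <= y <= q ->
  `|w y - (c + e * y)| <= K * (q - p) ^+ 2.
Proof.
move=> pq dw ddw wK cp cq /andP[py yq].
have ppq : p <= p <= q by rewrite lexx ltW.
have K0 : 0 <= K := le_trans (normr_ge0 _) (wK p ppq).
have mvt t : p <= t -> t <= q -> exists2 xi, p <= xi <= q & w t - w p = derive1 w xi * (t - p).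
  move=> pt tq; have [||xi + E] := @MVT_segment R w (derive1 w) p t pt.
  - move=> z; rewrite in_itv/= => /andP[h1 h2]; rewrite derive1E; apply/derivableP.
    by apply/dw; lra.
  - apply: derivable_within_continuous => z; rewrite in_itv/= => /andP[h1 h2].
    by apply/dw; lra.
  by rewrite in_itv/= => /andP[h1 h2]; exists xi => //; lra.
have [x1 x1pq E1] := mvt y py yq.
have [x2 x2pq E2] := mvt q (ltW pq) (lexx q).
have eE : e = derive1 w x2.
  have qp : q - p != 0 by lra.
  by apply: (mulIf qp); rewrite -E2 -cp -cq; ring.
have -> : w y - (c + e * y) = (derive1 w x1 - derive1 w x2) * (y - p).
  by rewrite mulrBl -E1 -eE -cp; ring.
have h : `|derive1 w x1 - derive1 w x2| <= K * `|x1 - x2|.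
  apply: (mean_value_norm_le ddw _ x1pq x2pq) => z zpq.
  by have := wK z zpq; rewrite derive1nS derive1n1.
rewrite normrM expr2 mulrA; apply: ler_pM => //.
  apply: (le_trans h); rewrite ler_wpM2l// ler_norml; lra.
by rewrite ger0_norm; lra.
Qed.

(** * Geometry of the graded mesh *)

Definition graded_dist (R : realType) (a b r : R) (N j : nat) : R :=
  (b - a) / 2 * (j%:R / N%:R) `^ r.

Section GradedMesh.
Context {R : realType}.
Variables (a b r : R) (N : nat).
Hypotheses (ab : a < b) (r0 : 0 < r) (N0 : (0 < N)%N).

Local Notation x := (graded_mesh a b r N).
Local Notation d := (graded_dist a b r N).

Lemma graded_mesh_left j : (j <= N)%N -> x j = a + d j.
Proof. by move=> jN; rewrite /graded_mesh jN. Qed.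

Lemma graded_mesh_right j : (j <= N)%N -> x (N.*2 - j)%N = b - d j.
Proof.
move=> jN; have NR : N%:R != 0 :> R by rewrite pnatr_eq0 -lt0n.
(* Only [j = N] lands in the left branch of the mesh definition, and there both formulas give the
   midpoint. *)
rewrite /graded_mesh; case: ifPn => [h|_].
  have -> : j = N by apply/eqP; rewrite eqn_leq jN; move: h; rewrite -addnn; lia.
  by rewrite -addnn addnK /graded_dist divff// powR1; field.
rewrite natrB; last by rewrite -addnn; lia.
rewrite /graded_dist; congr (_ - _ * (_ `^ _)); rewrite -muln2 natrM; field; exact: NR.
Qed.

Lemma graded_dist_ge0 j : 0 <= d j.
Proof. by rewrite mulr_ge0 ?powR_ge0// divr_ge0 ?subr_ge0 ?ltW. Qed.

Lemma graded_dist0 : d 0 = 0.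
Proof. by rewrite /graded_dist mul0r powR0 ?mulr0// gt_eqF. Qed.

Lemma graded_dist_gt0 j : (0 < j)%N -> 0 < d j.
Proof.
by move=> j0; rewrite mulr_gt0 ?divr_gt0 ?subr_gt0// powR_gt0// divr_gt0 ?ltr0n.
Qed.

Lemma graded_dist_lt i j : (i < j)%N -> d i < d j.
Proof.
move=> ij; rewrite ltr_pM2l ?divr_gt0 ?subr_gt0//.
apply: gt0_ltr_powR => //; rewrite ?nnegrE ?divr_ge0//.
by rewrite ltr_pM2r ?invr_gt0 ?ltr0n// ltr_nat.
Qed.

Lemma graded_dist_le i : (i <= N)%N -> d i <= (b - a) / 2.
Proof.
move=> iN; have NR : N%:R != 0 :> R by rewrite pnatr_eq0 -lt0n.
have -> : (b - a) / 2 = d N by rewrite /graded_dist divff// powR1 mulr1.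
by move: iN; rewrite leq_eqVlt => /predU1P[->//|/graded_dist_lt/ltW].
Qed.

Lemma graded_mesh0 : x 0 = a.
Proof. by rewrite graded_mesh_left// graded_dist0 addr0. Qed.

Lemma graded_mesh_end : x N.*2 = b.
Proof. by have := @graded_mesh_right 0 isT; rewrite subn0 graded_dist0 subr0. Qed.

Lemma graded_mesh_itv k : (0 < k < N.*2)%N -> a < x k < b.
Proof.
move=> /andP[k0 k2]; have [kN|Nk] := leqP k N.
  rewrite graded_mesh_left//; have := graded_dist_gt0 k0; have := graded_dist_le kN.
  lra.
have -> : k = (N.*2 - (N.*2 - k))%N by rewrite subKn// ltnW.
have j0 : (0 < N.*2 - k)%N by rewrite subn_gt0.
have jN : (N.*2 - k <= N)%N by move: Nk; rewrite -addnn; lia.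
rewrite graded_mesh_right//; have := graded_dist_gt0 j0; have := graded_dist_le jN.
lra.
Qed.

Lemma graded_cellP k : (1 <= k <= N.*2)%N -> exists2 j, (1 <= j <= N)%N &
  (x k.-1 = a + d j.-1 /\ x k = a + d j) \/ (x k.-1 = b - d j /\ x k = b - d j.-1).
Proof.
case: k => // k /andP[_ k2]; have [kN|Nk] := ltnP k N.
  by exists k.+1 => //; left; rewrite !graded_mesh_left// ltnW.
exists (N.*2 - k)%N; first by move: k2 Nk; rewrite -addnn; lia.
right; split.
  rewrite -graded_mesh_right; last by move: k2 Nk; rewrite -addnn; lia.
  by congr graded_mesh; move: k2; lia.
rewrite -graded_mesh_right; last by move: k2 Nk; rewrite -addnn; lia.
by congr graded_mesh; move: k2; lia.
Qed.

Lemma graded_mesh_cover y : a <= y <= b ->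
  exists2 k, (1 <= k <= N.*2)%N & x k.-1 <= y <= x k.
Proof.
move=> /andP[ay yb].
have ex : exists k, (0 < k)%N && (y <= x k).
  by exists N.*2; rewrite graded_mesh_end yb andbT double_gt0.
case: (ex_minnP ex) => k /andP[k0 yk] kmin; exists k.
  by rewrite k0 kmin// graded_mesh_end yb andbT double_gt0.
rewrite yk andbT; case: k k0 {yk} kmin => // -[|k] _ kmin.
  by rewrite graded_mesh0.
rewrite leNgt; apply/negP => /ltW h; have := kmin k.+1; rewrite h => /(_ isT).
by rewrite ltnn.
Qed.

End GradedMesh.

(** * Interpolation error for functions of low regularity *)

Section InterpolationError.
Context {R : realType}.
Variables (a b r sigma C0 : R) (w : R -> R).
Hypotheses (ab : a < b) (r0 : 0 < r) (sigma01 : 0 < sigma < 1) (C00 : 0 <= C0).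
Hypotheses (w_class : class_Cn a b 2 w)
  (w_bound : forall (l : nat) (x : R), (l <= 2)%N -> a < x < b ->
      `|derive1n l w x| <= C0 * ((x - a) * (b - x)) `^ (sigma - l%:R))
  (wa : w a = 0) (wb : w b = 0).

Let L := (b - a) / 2.

Let L0 : 0 < L. Proof. by rewrite divr_gt0// subr_gt0. Qed.

(** In one half of the interval, one of [z - a] and [b - z] is at least [rho] and the other at least
    [L], so the singular bound on the second derivative is at most [C0 * (rho * L)^(sigma - 2)]
    throughout the cell. *)
Lemma interior_cell_error (p q c e y rho : R) :
  0 < rho -> rho <= L -> p < q -> a + rho <= p -> q <= b - rho ->
  (q <= a + L \/ b - L <= p) ->
  c + e * p = w p -> c + e * q = w q -> p <= y <= q ->
  `|w y - (c + e * y)| <=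
    C0 * L `^ (sigma - 2) * ((q - p) ^+ 2 * rho `^ (sigma - 2)).
Proof.
move=> rho0 rhoL pq ap qb half cp cq ypq; have LE : b - a = 2 * L by rewrite /L; field.
have In z : p <= z <= q -> a < z < b by lra.
rewrite [leRHS](_ : _ = (C0 * (rho * L) `^ (sigma - 2)) * (q - p) ^+ 2); last first.
  by rewrite powRM ?(ltW rho0) ?(ltW L0)//; ring.
apply: affine_interpolation_error => // z zpq; have zab := In z zpq.
- by have := w_class.1 0%N z isT zab; rewrite derive1n0.
- by have := w_class.1 1%N z isT zab; rewrite derive1n1.
apply: (le_trans (w_bound (leqnn 2) zab)); rewrite ler_wpM2l//.
have rL : 0 < rho * L by rewrite mulr_gt0.
have [s0 s1] := andP sigma01; apply: ler_powR_nonpos => //; first lra.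
have [h|h] := half.
  by apply: ler_pM; lra.
by rewrite mulrC; apply: ler_pM; lra.
Qed.

(** No second derivative bound is available up to the endpoint, so [w] and its interpolant are
    estimated separately: an affine function is bounded by its end values, hence the factor 2. *)
Lemma end_cell_error (p q c e y rho : R) :
  0 < rho -> rho <= L -> p <= q ->
  (p = a /\ q = a + rho) \/ (p = b - rho /\ q = b) ->
  c + e * p = w p -> c + e * q = w q -> p <= y <= q ->
  `|w y - (c + e * y)| <= 2 * C0 * (2 * L) `^ sigma * rho `^ sigma.
Proof.
move=> rho0 rhoL pq ends cp cq ypq.
have LE : b - a = 2 * L by rewrite /L; field.
have Bw z : p <= z <= q -> `|w z| <= C0 * (2 * L) `^ sigma * rho `^ sigma.
  move=> zpq.
  have R0 : 0 <= C0 * (2 * L) `^ sigma * rho `^ sigma by rewrite !mulr_ge0 ?powR_ge0.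
  have [->|za] := eqVneq z a; first by rewrite wa normr0.
  have [->|zb] := eqVneq z b; first by rewrite wb normr0.
  have zab : a < z < b.
    rewrite !lt_neqAle eq_sym za zb /=; case: ends => -[]; lra.
  have := w_bound (leq0n 2) zab; rewrite derive1n0 subr0 => /le_trans; apply.
  have L20 : 0 <= 2 * L by lra.
  rewrite -mulrA ler_wpM2l// -(powRM _ L20 (ltW rho0)).
  have [s0 s1] := andP sigma01.
  apply: ge0_ler_powR; rewrite ?nnegrE; [lra|rewrite mulr_ge0; lra|rewrite !mulr_ge0; lra|].
  case: ends => -[E1 E2].
    by rewrite mulrC; apply: ler_pM; lra.
  by apply: ler_pM; lra.
apply: (le_trans (ler_normB (w y) (c + e * y))).
have h1 := Bw y ypq.
have h2 : `|c + e * y| <= C0 * (2 * L) `^ sigma * rho `^ sigma.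
  by apply: affine_norm_le ypq; rewrite ?cp ?cq; apply: Bw; rewrite lexx ?andbT.
rewrite -!mulrA in h1 h2 *; lra.
Qed.

Definition interpolation_const : R :=
  C0 * L `^ (sigma - 2) * graded_cell_const L r sigma
  + 2 * C0 * (2 * L) `^ sigma * (L `^ sigma / (2 * L) `^ (graded_exponent r sigma)).

Let interior_const_ge0 : 0 <= C0 * L `^ (sigma - 2) * graded_cell_const L r sigma.
Proof.
apply: mulr_ge0 (graded_cell_const_ge0 _ _ _).
exact: mulr_ge0 C00 (powR_ge0 _ _).
Qed.

Let end_const_ge0 : 0 <= 2 * C0 * (2 * L) `^ sigma *
  (L `^ sigma / (2 * L) `^ (graded_exponent r sigma)).
Proof.
apply: mulr_ge0; last exact: divr_ge0 (powR_ge0 _ _) (powR_ge0 _ _).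
by apply: mulr_ge0 (powR_ge0 _ _); apply: mulr_ge0.
Qed.

Lemma interpolation_const_ge0 : 0 <= interpolation_const.
Proof. exact: addr_ge0 interior_const_ge0 end_const_ge0. Qed.

Lemma interpolation_error_le (N : nat) (s : R -> R) : (0 < N)%N ->
  (forall k, (1 <= k <= N.*2)%N -> exists c e, forall y,
     graded_mesh a b r N k.-1 <= y <= graded_mesh a b r N k -> s y = c + e * y) ->
  (forall k, (k <= N.*2)%N -> s (graded_mesh a b r N k) = w (graded_mesh a b r N k)) ->
  forall y, a <= y <= b -> `|w y - s y| <=
    interpolation_const * N%:R ^- 2
      * end_weight a b (graded_exponent r sigma) (L * N%:R `^ (- r)) y.
Proof.
move=> N0 saff snode y yab.
have [k k1 yk] := graded_mesh_cover ab r0 N0 yab.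
have [c [e ce]] := saff k k1.
have LE : b - a = 2 * L by rewrite /L; field.
set beta := graded_exponent r sigma; set delta := L * _.
pose d := graded_dist a b r N.
have [j /andP[j1 jN] cell] := graded_cellP ab r0 N0 k1.
have djj : d j.-1 < d j by apply: graded_dist_lt => //; rewrite ltn_predL.
have djL : d j <= L by exact: graded_dist_le.
have dj0 : 0 <= d j.-1 by exact: graded_dist_ge0.
have k2 : (k <= N.*2)%N by case/andP: k1.
have k2' : (k.-1 <= N.*2)%N by rewrite (leq_trans (leq_pred _)).
set p := graded_mesh a b r N k.-1 in ce yk cell *.
set q := graded_mesh a b r N k in ce yk cell *.
have pq : p < q by case: cell => -[-> ->]; rewrite -/d; lra.
have cp : c + e * p = w p by rewrite -ce ?snode// lexx ltW.
have cq : c + e * q = w q by rewrite -ce ?snode// lexx ltW.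
rewrite ce//.
(* The distance to the endpoint on the cell's own side of the midpoint; this endpoint's term of the
   weight already suffices. *)
pose z := if q <= a + L then y - a else b - y.
have zP : 0 <= z <= d j.
  rewrite /z; case: ifPn; rewrite -?ltNge => h; case: cell => -[E1 E2]; move: E1 E2; rewrite -/d; lra.
have zW : (z + delta) `^ beta <= end_weight a b beta delta y.
  by rewrite /end_weight /z; case: ifPn => _; rewrite ?lerDl ?lerDr powR_ge0.
have W0 := end_weight_ge0 a b beta delta y.
have N2 : 0 <= N%:R ^- 2 :> R by rewrite invr_ge0 exprn_ge0.
have c1 := interior_const_ge0; have c2 := end_const_ge0.
rewrite /interpolation_const -/beta 2!mulrDl.
have [j2|j2] := leqP 2 j.
  apply: ler_wpDr; first by apply: mulr_ge0 => //; exact: mulr_ge0.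
  apply: (@le_trans _ _ (C0 * L `^ (sigma - 2) * ((q - p) ^+ 2 * d j.-1 `^ (sigma - 2)))).
    have dj0' : 0 < d j.-1 by apply: graded_dist_gt0 => //; case: j j2 {j1 jN cell djj djL dj0 zP} => [|[]].
    have half : q <= a + L \/ b - L <= p.
      by case: cell => -[-> ->]; rewrite -/d; [left|right]; lra.
    apply: (interior_cell_error dj0' _ pq _ _ half cp cq yk).
    - lra.
    - by case: cell => -[E1 E2]; rewrite E1 ?E2 -/d; lra.
    - by case: cell => -[E1 E2]; rewrite E2 -/d; lra.
  have -> : q - p = d j - d j.-1 by case: cell => -[-> ->]; rewrite -/d; ring.
  have c3 : 0 <= C0 * L `^ (sigma - 2) by exact: mulr_ge0 C00 (powR_ge0 _ _).
  rewrite -!(mulrA (C0 * _)); apply: ler_wpM2l => //.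
  apply: (le_trans (@graded_cell _ L r sigma L0 r0 N j z _ _)); rewrite ?j2//.
  rewrite -/beta -/delta ler_wpM2l// mulr_ge0//.
  exact: graded_cell_const_ge0.
have jE : j = 1%N by apply/eqP; rewrite eqn_leq j1 andbT -ltnS.
apply: ler_wpDl; first by apply: mulr_ge0 => //; exact: mulr_ge0.
apply: (@le_trans _ _ (2 * C0 * (2 * L) `^ sigma * d j `^ sigma)).
  have d0 : d 0 = 0 by exact: graded_dist0.
  apply: (end_cell_error _ djL (ltW pq) _ cp cq yk); first lra.
  by rewrite jE /= in cell *; case: cell => -[-> ->]; rewrite -/d d0 ?addr0 ?subr0; [left|right].
have c3 : 0 <= 2 * C0 * (2 * L) `^ sigma.
  by apply: mulr_ge0 (powR_ge0 _ _); apply: mulr_ge0.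
rewrite -!(mulrA (2 * C0 * _)); apply: ler_wpM2l => //.
rewrite jE in zP *.
apply: (le_trans (@graded_first_cell _ L r sigma L0 r0 N z _ _)) => //.
rewrite -/beta -/delta; apply: ler_wpM2l => //.
by apply: mulr_ge0 => //; exact: divr_ge0 (powR_ge0 _ _) (powR_ge0 _ _).
Qed.

End InterpolationError.

(** * The nonlocal operator and stability of the scheme *)

Lemma bounded_Rintegral (R : realType) (a b B : R) (h g : R -> R) :
  measurable_fun `[a, b] h -> measurable_fun `[a, b] g ->
  (forall y, a <= y <= b -> `|h y| <= g y) ->
  (\int[lebesgue_measure]_(y in `[a, b]) (g y)%:E <= B%:E)%E ->
  lebesgue_measure.-integrable `[a, b] (EFin \o h) /\
  `|\int[lebesgue_measure]_(y in `[a, b]) h y| <= B.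
Proof.
move=> mh mg hg gB.
have hB : (\int[lebesgue_measure]_(y in `[a, b]) `|(h y)%:E| <= B%:E)%E.
  apply: le_trans gB; apply: ge0_le_integral => //=.
  - by do 2 apply: measurableT_comp => //.
  - exact/measurable_EFinP.
have ih : lebesgue_measure.-integrable `[a, b] (EFin \o h).
  apply/integrableP; split; first exact/measurable_EFinP.
  by apply: (le_lt_trans hB); rewrite ltry.
split; first exact: ih.
rewrite -lee_fin EFin_normr_Rintegral//.
apply: le_trans hB; apply: le_abse_integral => //.
exact/measurable_EFinP.
Qed.

Section NonlocalOperator.
Context {R : realType}.
Variables (a b alpha K : R).
Hypothesis kernel_le : forall x, a <= x <= b ->
  (\int[lebesgue_measure]_(y in `[a, b]) ((`|x - y| `^ alpha)^-1)%:E <= K%:E)%E.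

(** A class containing both the piecewise linear interpolants and the exact solution at a fixed
    time, on which integrability of the kernel makes the operator linear and bounded. *)
Definition bounded_mfun (g : R -> R) :=
  measurable_fun `[a, b] g /\ exists m, forall y, a <= y <= b -> `|g y| <= m.

(** The sign is that of the collocation matrix, opposite to [nonlocal_integrand]. *)
Definition nonlocal_op (g : R -> R) (x : R) : R :=
  \int[lebesgue_measure]_(y in `[a, b]) ((g x - g y) / `|x - y| `^ alpha).

Let integrand (g : R -> R) (x y : R) := (g x - g y) / `|x - y| `^ alpha.

Lemma bounded_mfunD g h : bounded_mfun g -> bounded_mfun h ->
  bounded_mfun (fun y => g y + h y).
Proof.
move=> [mg [m gm]] [mh [n hn]]; split; first exact: measurable_funD.
by exists (m + n) => y yab; rewrite (le_trans (ler_normD _ _))// lerD ?gm ?hn.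
Qed.

Lemma bounded_mfunZ c g : bounded_mfun g -> bounded_mfun (fun y => c * g y).
Proof.
move=> [mg [m gm]]; split; first exact: measurable_funM.
by exists (`|c| * m) => y yab; rewrite normrM ler_wpM2l ?gm.
Qed.

Lemma bounded_mfunB g h : bounded_mfun g -> bounded_mfun h ->
  bounded_mfun (fun y => g y - h y).
Proof.
move=> bg bh; have := bounded_mfunD bg (bounded_mfunZ (-1) bh).
by under eq_fun do rewrite mulN1r.
Qed.

Lemma measurable_integrand g x : bounded_mfun g -> measurable_fun `[a, b] (integrand g x).
Proof.
move=> [mg _]; apply: measurable_funM; last exact: measurable_riesz.
exact: measurable_funB.
Qed.

(** A constant [W] gives boundedness in the maximum norm, hence stability; [W] proportional to the
    endpoint weight gives consistency. *)
Lemma nonlocal_op_bound (g W : R -> R) (x B : R) :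
  bounded_mfun g -> measurable_fun `[a, b] W ->
  (forall y, a <= y <= b -> `|g x - g y| <= W y) ->
  (\int[lebesgue_measure]_(y in `[a, b]) (W y * (`|x - y| `^ alpha)^-1)%:E <= B%:E)%E ->
  lebesgue_measure.-integrable `[a, b] (EFin \o integrand g x) /\
  `|nonlocal_op g x| <= B.
Proof.
move=> bg mW gW WB; apply: (bounded_Rintegral _ _ _ WB).
- exact: measurable_integrand.
- by apply: measurable_funM => //; exact: measurable_riesz.
- move=> y yab; rewrite normrM normfV (ger0_norm (powR_ge0 _ _)).
  by rewrite ler_wpM2r ?invr_ge0 ?powR_ge0 ?gW.
Qed.

Let nonlocal_op_main g x m : a <= x <= b -> bounded_mfun g ->
  (forall y, a <= y <= b -> `|g y| <= m) ->
  lebesgue_measure.-integrable `[a, b] (EFin \o integrand g x) /\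
  `|nonlocal_op g x| <= 2 * m * K.
Proof.
move=> xab bg gm; have m0 : 0 <= m := le_trans (normr_ge0 _) (gm x xab).
have m20 : 0 <= 2 * m by rewrite mulr_ge0.
apply: (@nonlocal_op_bound g (cst (2 * m))) => //.
- move=> y yab; rewrite (le_trans (ler_normB (g x) (g y)))//=.
  by rewrite mulr_natl mulr2n lerD ?gm.
- under eq_integral do rewrite /cst EFinM.
  rewrite ge0_integralZl//=.
  + by rewrite (EFinM (2 * m)) lee_wpmul2l ?lee_fin// kernel_le.
  + by apply/measurable_EFinP; exact: measurable_riesz.
Qed.

Lemma nonlocal_op_le g x m : a <= x <= b -> bounded_mfun g ->
  (forall y, a <= y <= b -> `|g y| <= m) -> `|nonlocal_op g x| <= 2 * m * K.
Proof. by move=> xab bg gm; have [] := nonlocal_op_main xab bg gm. Qed.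

Lemma nonlocal_op_integrable g x : a <= x <= b -> bounded_mfun g ->
  lebesgue_measure.-integrable `[a, b]
    (EFin \o (fun y => (g x - g y) / `|x - y| `^ alpha)).
Proof.
by move=> xab bg; have [_ [m gm]] := bg; have [] := nonlocal_op_main xab bg gm.
Qed.

Lemma nonlocal_opD g h x : a <= x <= b -> bounded_mfun g -> bounded_mfun h ->
  nonlocal_op (fun y => g y + h y) x = nonlocal_op g x + nonlocal_op h x.
Proof.
move=> xab bg bh; rewrite /nonlocal_op -RintegralD//; first last.
- exact: nonlocal_op_integrable.
- exact: nonlocal_op_integrable.
by apply: eq_Rintegral => y _ /=; rewrite -mulrDl; congr (_ / _); ring.
Qed.

Lemma nonlocal_opZ c g x : a <= x <= b -> bounded_mfun g ->
  nonlocal_op (fun y => c * g y) x = c * nonlocal_op g x.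
Proof.
move=> xab bg; rewrite /nonlocal_op -RintegralZl//; last exact: nonlocal_op_integrable.
by apply: eq_Rintegral => y _ /=; rewrite mulrA mulrBr.
Qed.

Lemma nonlocal_opB g h x : a <= x <= b -> bounded_mfun g -> bounded_mfun h ->
  nonlocal_op (fun y => g y - h y) x = nonlocal_op g x - nonlocal_op h x.
Proof.
move=> xab bg bh; rewrite -mulN1r -(nonlocal_opZ _ xab bh) -nonlocal_opD//.
  by congr nonlocal_op; apply/funext => y; rewrite mulN1r.
exact: bounded_mfunZ.
Qed.

Lemma bounded_mfun_sum n (c : 'I_n -> R) (g : 'I_n -> R -> R) :
  (forall i, bounded_mfun (g i)) ->
  bounded_mfun (fun y => \sum_(i < n) c i * g i y).
Proof.
elim: n c g => [|n IH] c g bg.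
  under eq_fun do rewrite big_ord0; split; first exact: measurable_cst.
  by exists 0 => y _; rewrite normr0.
under eq_fun do rewrite big_ord_recr /=.
by apply: bounded_mfunD; [exact: IH|exact: bounded_mfunZ].
Qed.

Lemma nonlocal_op_sum n (c : 'I_n -> R) (g : 'I_n -> R -> R) x :
  a <= x <= b -> (forall i, bounded_mfun (g i)) ->
  nonlocal_op (fun y => \sum_(i < n) c i * g i y) x =
  \sum_(i < n) c i * nonlocal_op (g i) x.
Proof.
move=> xab; elim: n c g => [|n IH] c g bg.
  rewrite big_ord0 /nonlocal_op.
  under eq_Rintegral do rewrite !big_ord0 subrr mul0r.
  by rewrite /Rintegral integral0.
under eq_fun do rewrite big_ord_recr /=.
rewrite nonlocal_opD//; first last.
- exact: bounded_mfunZ.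
- exact: bounded_mfun_sum.
by rewrite IH// nonlocal_opZ// [RHS]big_ord_recr.
Qed.

Lemma nonlocal_op_ge0 g x : (forall y, a <= y <= b -> g y <= g x) -> 0 <= nonlocal_op g x.
Proof.
move=> gx; apply: Rintegral_ge0 => y; rewrite /= in_itv/= => /gx h.
by rewrite mulr_ge0 ?subr_ge0 ?invr_ge0 ?powR_ge0.
Qed.

End NonlocalOperator.

(** * Piecewise linear interpolants and the collocation matrix *)

Section HatFunctions.
Context {R : realType}.
Variables (a b r : R) (N : nat) (phi : nat -> R -> R).
Hypotheses (ab : a < b) (r0 : 0 < r) (N0 : (0 < N)%N).
Hypothesis hat : forall j, (j <= N.*2)%N -> is_hat_function a b r N j (phi j).

Local Notation x := (graded_mesh a b r N).

Lemma piecewise_affine_norm_le (s : R -> R) (m : R) :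
  (forall k, (1 <= k <= N.*2)%N -> exists c e, forall y, x k.-1 <= y <= x k ->
     s y = c + e * y) ->
  (forall k, (k <= N.*2)%N -> `|s (x k)| <= m) ->
  forall y, a <= y <= b -> `|s y| <= m.
Proof.
move=> saff snode y yab.
have [k k1 yk] := graded_mesh_cover ab r0 N0 yab.
have [c [e ce]] := saff k k1; have /andP[h1 h2] := yk.
have k2 : (k <= N.*2)%N by case/andP: k1.
have k2' : (k.-1 <= N.*2)%N by rewrite (leq_trans (leq_pred _)).
have pq := le_trans h1 h2.
rewrite ce//; apply: affine_norm_le yk.
  by rewrite -ce ?snode// lexx.
by rewrite -ce ?snode// lexx andbT.
Qed.

Lemma hat_bounded_mfun j : (j <= N.*2)%N -> bounded_mfun a b (phi j).
Proof.
move=> j2; have [cphi aff node] := hat j2; split.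
  exact: subspace_continuous_measurable_fun.
exists 1; apply: piecewise_affine_norm_le => // k k2.
by rewrite node//; case: (_ == _); rewrite ?normr1 ?normr0.
Qed.

Definition hat_sum (v : 'cV[R]_(N.*2.-1)) (y : R) : R :=
  \sum_(i < N.*2.-1) v i 0 * phi i.+1 y.

Lemma interior_index (i : 'I_(N.*2.-1)) : (0 < i.+1 < N.*2)%N.
Proof. by have := ltn_ord i; move: N0; lia. Qed.

Let index_le (i : 'I_(N.*2.-1)) : (i.+1 <= N.*2)%N.
Proof. by have /andP[_ /ltnW] := interior_index i. Qed.

Lemma hat_sum_bounded_mfun v : bounded_mfun a b (hat_sum v).
Proof. by apply: bounded_mfun_sum => i; exact: hat_bounded_mfun. Qed.

Lemma hat_sum_affine v k : (1 <= k <= N.*2)%N -> exists c e,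
  forall y, x k.-1 <= y <= x k -> hat_sum v y = c + e * y.
Proof.
move=> k1.
have /choice[ce ceP] : forall i : 'I_(N.*2.-1), exists ce : R * R,
    forall y, x k.-1 <= y <= x k -> phi i.+1 y = ce.1 + ce.2 * y.
  move=> i; have [_ /(_ k k1)[c [e H]] _] := hat (index_le i).
  by exists (c, e).
exists (\sum_i v i 0 * (ce i).1), (\sum_i v i 0 * (ce i).2) => y yk.
rewrite mulr_suml -big_split; apply: eq_bigr => i _ /=.
by rewrite (ceP i y yk) mulrDr mulrA.
Qed.

Lemma hat_sum_node v (i : 'I_(N.*2.-1)) : hat_sum v (x i.+1) = v i 0.
Proof.
rewrite /hat_sum (bigD1 i)//= big1 ?addr0.
  by have [_ _ ->] := hat (index_le i); rewrite ?index_le// eqxx mulr1.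
move=> k ki; have [_ _ ->] := hat (index_le k); rewrite ?index_le//.
by rewrite eqSS (negbTE (ki : (k : nat) != i)) mulr0.
Qed.

Lemma hat_sum_end v k : (k == 0)%N || (k == N.*2)%N -> hat_sum v (x k) = 0.
Proof.
move=> kE; rewrite /hat_sum big1// => i _.
have k2 : (k <= N.*2)%N by case/orP: kE => /eqP ->.
have [_ _ ->//] := hat (index_le i); rewrite (_ : _ == _ = false) ?mulr0//.
by have := interior_index i; move: kE; lia.
Qed.

Lemma nodeP (k : nat) : (k <= N.*2)%N ->
  ((k == 0)%N || (k == N.*2)%N) \/ exists i : 'I_(N.*2.-1), k = i.+1.
Proof.
case: k => [|k] k2; first by left.
have [->|kn] := eqVneq k.+1 N.*2; first by left; rewrite orbT.
have kN : (k < N.*2.-1)%N by move: kn k2; lia.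
by right; exists (Ordinal kN).
Qed.

Lemma hat_sum_norm_le (v : 'cV[R]_(N.*2.-1)) (m : R) : 0 <= m -> (forall i, `|v i 0| <= m) ->
  forall y, a <= y <= b -> `|hat_sum v y| <= m.
Proof.
move=> m0 vm; apply: piecewise_affine_norm_le => k; first exact: hat_sum_affine.
move=> /nodeP[/hat_sum_end ->|[i ->]]; first by rewrite normr0.
by rewrite hat_sum_node.
Qed.

Lemma node_itv (i : 'I_(N.*2.-1)) : a < x i.+1 < b.
Proof. exact: graded_mesh_itv (interior_index i). Qed.

Lemma node_itv_le (i : 'I_(N.*2.-1)) : a <= x i.+1 <= b.
Proof. by have /andP[h1 h2] := node_itv i; rewrite !ltW. Qed.

Section Collocation.
Variables (alpha K : R).
Hypothesis kernel_le : forall x, a <= x <= b ->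
  (\int[lebesgue_measure]_(y in `[a, b]) ((`|x - y| `^ alpha)^-1)%:E <= K%:E)%E.

Local Notation A := (collocation_mx a b alpha r N phi).

Lemma mulmx_collocation v (i : 'I_(N.*2.-1)) :
  (A *m v) i 0 = nonlocal_op a b alpha (hat_sum v) (x i.+1).
Proof.
rewrite mxE /hat_sum (nonlocal_op_sum kernel_le)//; last 2 first.
- exact: node_itv_le.
- by move=> k; exact: hat_bounded_mfun.
by apply: eq_bigr => k _; rewrite mxE mulrC.
Qed.

Lemma kernel_bound_ge0 : 0 <= K.
Proof.
have := kernel_le (_ : a <= a <= b); rewrite lexx ltW// => /(_ isT).
rewrite -lee_fin; apply: le_trans; apply: integral_ge0 => y _.
by rewrite lee_fin invr_ge0 powR_ge0.
Qed.

(* Discrete maximum principle: at a node where [`|v|] is maximal, [A v] has the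
   sign of [v], because the interpolant of [v] lies below its maximal node. *)
Lemma implicit_stable (t g : R) (v : 'cV[R]_(N.*2.-1)) : 0 <= t ->
  (forall i, `|((1%:M + t *: A) *m v) i 0| <= g) -> forall i, `|v i 0| <= g.
Proof.
move=> t0 vg i0.
have [i imax] : exists i, forall k, `|v k 0| <= `|v i 0|.
  have [i _ H] := @arg_maxP _ _ _ i0 predT (fun i => `|v i 0|) isT.
  by exists i => k; exact: H.
apply: (le_trans (imax i0)); apply: le_trans (vg i).
rewrite mulmxDl mul1mx -scalemxAl !mxE -[\sum_j _](_ : (A *m v) i 0 = _); last by rewrite mxE.
rewrite mulmx_collocation.
have Vle := @hat_sum_norm_le v `|v i 0| (normr_ge0 _) imax.
have [v0|v0] := leP 0 (v i 0).
  have op0 : 0 <= nonlocal_op a b alpha (hat_sum v) (x i.+1).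
    apply: nonlocal_op_ge0 => y /Vle; rewrite hat_sum_node ler_norml ger0_norm//.
    by case/andP.
  by rewrite !ger0_norm// ?addr_ge0 ?mulr_ge0// lerDl mulr_ge0.
have op0 : 0 <= - nonlocal_op a b alpha (hat_sum v) (x i.+1).
  rewrite -mulN1r -(nonlocal_opZ kernel_le) ?node_itv_le//; last exact: hat_sum_bounded_mfun.
  apply: nonlocal_op_ge0 => y /Vle; rewrite hat_sum_node ler_norml ltr0_norm//.
  by case/andP; lra.
rewrite -[leRHS]normrN opprD -mulrN.
have nv : 0 <= - v i 0 by lra.
rewrite ltr0_norm// ger0_norm ?lerDl ?mulr_ge0// addr_ge0 ?mulr_ge0//.
Qed.

(** The explicit half step need not be a contraction in the maximum norm; with [t = tau / 2] it
    loses only a factor [1 + tau * K], with [K] independent of the mesh. *)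
Lemma explicit_bound (t m : R) (v : 'cV[R]_(N.*2.-1)) : 0 <= t -> 0 <= m ->
  (forall i, `|v i 0| <= m) ->
  forall i, `|((1%:M - t *: A) *m v) i 0| <= (1 + 2 * t * K) * m.
Proof.
move=> t0 m0 vm i.
rewrite mulmxBl mul1mx -scalemxAl !mxE -[\sum_j _](_ : (A *m v) i 0 = _); last by rewrite mxE.
rewrite mulmx_collocation.
have := nonlocal_op_le kernel_le (node_itv_le i) (hat_sum_bounded_mfun v)
  (hat_sum_norm_le m0 vm).
set O := nonlocal_op _ _ _ _ _ => OB.
apply: (le_trans (ler_normB (v i 0) (t * O))).
rewrite normrM (ger0_norm t0).
have := vm i; have : t * `|O| <= t * (2 * m * K) by rewrite ler_wpM2l.
lra.
Qed.

(** Each step multiplies the error by at most [1 + tau * K] and adds at most [tau * rho]; over at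
    most [M = 1 / tau] steps the product stays below [expR K]. *)
Lemma crank_nicolson_stable (M : nat) (rho : R) (e res : nat -> 'cV[R]_(N.*2.-1)) :
  (0 < M)%N -> 0 <= rho -> e 0%N = 0 ->
  (forall j, (1 <= j <= M)%N ->
    (1%:M + (M%:R^-1 / 2) *: A) *m e j =
    (1%:M - (M%:R^-1 / 2) *: A) *m e j.-1 + M%:R^-1 *: res j) ->
  (forall j i, (1 <= j <= M)%N -> `|res j i 0| <= rho) ->
  forall j i, (j <= M)%N -> `|e j i 0| <= expR K * rho.
Proof.
move=> M0 rho0 e0 erec resB.
have K0 := kernel_bound_ge0.
have MR : 0 < M%:R :> R by rewrite ltr0n.
set tau := M%:R^-1 in erec; have tau0 : 0 < tau by rewrite invr_gt0.
(* All [j] residuals are charged the full growth factor, which avoids a geometric sum. *)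
have step j : (j <= M)%N -> forall i, `|e j i 0| <= (1 + tau * K) ^+ j * (j%:R * tau * rho).
  elim: j => [_ i|j IH jM]; first by rewrite e0 mxE normr0 !mul0r mulr0.
  have G0 : 0 <= (1 + tau * K) ^+ j * (j%:R * tau * rho).
    by rewrite mulr_ge0 ?exprn_ge0 ?addr_ge0 ?mulr_ge0 ?(ltW tau0).
  apply: (@implicit_stable (tau / 2)); first by rewrite divr_ge0 ?ltW.
  move=> i; rewrite erec//= mxE.
  apply: (le_trans (ler_normD _ _)).
  have t20 : 0 <= tau / 2 by rewrite divr_ge0 ?ltW.
  have h1 := explicit_bound t20 G0 (IH (ltnW jM)) i.
  have h2 : `|(tau *: res j.+1) i 0| <= tau * rho.
    by rewrite mxE normrM (gtr0_norm tau0) ler_pM2l// resB.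
  have p1 : 1 <= (1 + tau * K) ^+ j.+1.
    by rewrite exprn_ege1// lerDl mulr_ge0// ltW.
  have h3 : tau * rho <= (1 + tau * K) ^+ j.+1 * (tau * rho).
    by rewrite ler_peMl// mulr_ge0// ltW.
  apply: (le_trans (lerD h1 h2)).
  rewrite (_ : 2 * (tau / 2) * K = tau * K); last by field.
  apply: (@le_trans _ _ ((1 + tau * K) * ((1 + tau * K) ^+ j * (j%:R * tau * rho))
     + (1 + tau * K) ^+ j.+1 * (tau * rho))); first by rewrite lerD2l.
  rewrite le_eqVlt; apply/orP; left; apply/eqP.
  by rewrite exprS -natr1; ring.
move=> j i jM; apply: (le_trans (step j jM i)).
have jt : j%:R * tau <= 1 by rewrite ler_pdivrMr// mul1r ler_nat.
apply: ler_pM.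
- by rewrite exprn_ge0// addr_ge0// mulr_ge0// ltW.
- by rewrite !mulr_ge0// ltW.
- apply: (@le_trans _ _ (expR (tau * K) ^+ j)).
    rewrite lerXn2r ?nnegrE ?expR_ge0 ?expR_ge1Dx//.
    by rewrite addr_ge0// mulr_ge0// ltW.
  rewrite -expRM_natl ler_expR mulrA.
  by rewrite ler_piMl.
- by rewrite ler_piMl.
Qed.

End Collocation.

End HatFunctions.

(** * Consistency and convergence *)

Section TimeRegularity.
Context {R : realType}.
Variables (g : R -> R) (C1 : R).
Hypotheses (dg : forall t, 0 < t -> derivable g t 1)
  (g0 : g t @[t --> 0^'+] --> g 0)
  (dgn : forall t, 0 < t < 1 ->
     [/\ forall l : nat, (l < 3)%N -> derivable (derive1n l g) t 1,
         `|derive1n 2 g t| <= C1 & `|derive1n 3 g t| <= C1]).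

(** Right continuity at 0 is what admits the first time step, whose interval starts at [p = 0]. *)
Let within_segment (p q : R) : 0 <= p -> p < q -> {within `[p, q], continuous g}.
Proof.
move=> p0 pq.
have cg t : 0 < t -> {for t, continuous g}.
  by move=> t0; apply: differentiable_continuous; apply/derivable1_diffP/dg.
apply/continuous_within_itvP => //; split.
- by move=> t; rewrite in_itv/= => /andP[pt _]; apply: cg; lra.
- move: p0; rewrite le_eqVlt => /predU1P[<-//|p0].
  by apply: cvg_at_right_filter; exact: cg.
- by apply: cvg_at_left_filter; apply: cg; lra.
Qed.

Let derivative_lipschitz t s : 0 < t < 1 -> 0 < s < 1 ->
  `|derive1 g t - derive1 g s| <= C1 * `|t - s|.
Proof.
move=> t01 s01; pose p := Num.min t s; pose q := Num.max t s.
have In z : p <= z <= q -> 0 < z < 1.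
  by rewrite /p /q ge_min le_max => /andP[/orP[] h1 /orP[] h2]; lra.
apply: (@mean_value_norm_le _ (derive1 g) p q).
- by move=> z /In /dgn[/(_ 1%N isT)]; rewrite derive1n1.
- by move=> z /In /dgn[_ h _]; move: h; rewrite derive1nS derive1n1.
- by rewrite /p /q ge_min le_max !lexx.
- by rewrite /p /q ge_min le_max !lexx !orbT.
Qed.

Let second_derivative_lipschitz t s : 0 < t < 1 -> 0 < s < 1 ->
  `|derive1n 2 g t - derive1n 2 g s| <= C1 * `|t - s|.
Proof.
move=> t01 s01; pose p := Num.min t s; pose q := Num.max t s.
have In z : p <= z <= q -> 0 < z < 1.
  by rewrite /p /q ge_min le_max => /andP[/orP[] h1 /orP[] h2]; lra.
apply: (@mean_value_norm_le _ (derive1n 2 g) p q).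
- by move=> z /In /dgn[/(_ 2%N isT)].
- by move=> z /In /dgn[_ _]; rewrite derive1nS.
- by rewrite /p /q ge_min le_max !lexx.
- by rewrite /p /q ge_min le_max !lexx !orbT.
Qed.

Let C10 : 0 <= C1.
Proof.
have h : 0 < (2^-1 : R) < 1 by lra.
by have [_ /(le_trans (normr_ge0 _))] := dgn h.
Qed.

Let is_derive_g (t : R) : 0 < t -> is_derive t 1 g (derive1 g t).
Proof. by move=> t0; rewrite derive1E; apply/derivableP/dg. Qed.

(** The second difference is [h] times the difference of [g'] at two interior points less than
    [2 * h] apart, so no derivative at time 0 is involved. *)
Lemma midpoint_average_error (c h : R) : 0 < h -> 0 <= c - h -> c + h <= 1 ->
  `|(g (c + h) + g (c - h)) / 2 - g c| <= C1 * h ^+ 2.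
Proof.
move=> h0 ch0 ch1.
have [x1 x1c E1] : exists2 x1, c < x1 < c + h & g (c + h) - g c = derive1 g x1 * h.
  have [|||xi + E] := @MVT R g (derive1 g) c (c + h); first lra.
  - by move=> t; rewrite in_itv/= => ?; apply: is_derive_g; lra.
  - by apply: within_segment; lra.
  by rewrite in_itv/= => xic; exists xi => //; rewrite E; congr (_ * _); ring.
have [x2 x2c E2] : exists2 x2, c - h < x2 < c & g c - g (c - h) = derive1 g x2 * h.
  have [|||xi + E] := @MVT R g (derive1 g) (c - h) c; first lra.
  - by move=> t; rewrite in_itv/= => ?; apply: is_derive_g; lra.
  - by apply: within_segment; lra.
  by rewrite in_itv/= => xic; exists xi => //; rewrite E; congr (_ * _); ring.
have -> : (g (c + h) + g (c - h)) / 2 - g c = (derive1 g x1 - derive1 g x2) * h / 2.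
  by rewrite mulrBl -E1 -E2; field.
have B : `|derive1 g x1 - derive1 g x2| <= C1 * (2 * h).
  apply: (le_trans (derivative_lipschitz _ _)); [lra|lra|].
  by rewrite ler_wpM2l// ger0_norm; lra.
rewrite !normrM (gtr0_norm h0) normfV (ger0_norm (ler0n R 2)).
have : `|derive1 g x1 - derive1 g x2| * h <= C1 * (2 * h) * h by rewrite ler_pM2r.
lra.
Qed.

(* Subtracting the second order Taylor polynomial at [c] leaves a function with
   derivative O(h^2), and the quadratic term cancels in the central difference. *)
Lemma midpoint_difference_error (c h : R) : 0 < h -> 0 <= c - h -> c + h <= 1 ->
  `|g (c + h) - g (c - h) - 2 * h * derive1 g c| <= 2 * C1 * h ^+ 3.
Proof.
move=> h0 ch0 ch1; have c01 : 0 < c < 1 by lra.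
set k := derive1n 2 g c.
pose P (t : R) := g t - (derive1 g c * t + k / 2 * (t - c) ^+ 2).
pose dP (t : R) := derive1 g t - (derive1 g c + k * (t - c)).
have dQ (t : R) : is_derive t 1 (fun t : R => derive1 g c * t + k / 2 * (t - c) ^+ 2)
    (derive1 g c + k * (t - c)).
  have d1 : is_derive t 1 (fun s : R => s - c) 1.
    by apply: is_derive_eq; rewrite ?oppr0 ?addr0 ?mul1r.
  have d2 := is_deriveM d1 d1.
  have := is_deriveD (is_deriveZ (derive1 g c) (is_derive_id t (1 : R)))
    (is_deriveZ (k / 2) d2).
  move/is_derive_eq; apply; rewrite /GRing.scale /=; by field.
have [|||xi + E] := @MVT R P dP (c - h) (c + h); first lra.
- move=> t; rewrite in_itv/= => tc; have t0 : 0 < t by lra.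
  by have := is_deriveB (is_derive_g t0) (dQ t); apply.
- have cg : {within `[c - h, c + h], continuous g} by apply: within_segment; lra.
  have cQ : {within `[c - h, c + h], continuous (fun t : R => derive1 g c * t + k / 2 * (t - c) ^+ 2)}.
    apply: derivable_within_continuous => t _; have := dQ t => ?; exact: ex_derive.
  by move=> t; apply: cvgB; [exact: cg|exact: cQ].
rewrite in_itv/= => xic.
have -> : g (c + h) - g (c - h) - 2 * h * derive1 g c = P (c + h) - P (c - h).
  by rewrite /P; field.
have B : `|dP xi| <= C1 * h ^+ 2.
  have [eta etac Eeta] : exists2 eta, 0 < eta < 1 /\ `|eta - c| <= h &
      derive1 g xi - derive1 g c = derive1n 2 g eta * (xi - c).
    have d2 (t : R) : 0 < t < 1 -> is_derive t 1 (derive1 g) (derive1n 2 g t).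
      move=> t01; have [/(_ 1%N isT) + _ _] := dgn t01.
      by rewrite derive1n1 derive1nS derive1n1 => ?; rewrite derive1E; exact/derivableP.
    have c2 (p q : R) : 0 < p -> q < 1 -> {within `[p, q], continuous (derive1 g)}.
      move=> p0 q1; apply: derivable_within_continuous => t; rewrite in_itv/= => tpq.
      have t01 : 0 < t < 1 by lra.
      by have := d2 t t01 => ?; exact: ex_derive.
    have [cx|xc] := leP c xi.
      have [||eta + E2] := @MVT_segment R (derive1 g) (derive1n 2 g) c xi cx.
      - by move=> t; rewrite in_itv/= => tc; apply: d2; lra.
      - by apply: c2; lra.
      by rewrite in_itv/= => etac; exists eta => //; split; [lra|rewrite ger0_norm; lra].
    have [||eta + E2] := @MVT_segment R (derive1 g) (derive1n 2 g) xi c (ltW xc).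
    - by move=> t; rewrite in_itv/= => tc; apply: d2; lra.
    - by apply: c2; lra.
    rewrite in_itv/= => etac; exists eta; first by split; [lra|rewrite ler0_norm; lra].
    by rewrite -opprB E2 -mulrN opprB.
  have [eta01 etah] := etac.
  have -> : dP xi = (derive1n 2 g eta - k) * (xi - c).
    rewrite /dP; clearbody k; move: Eeta.
    move: (derive1 g xi) (derive1 g c) (derive1n 2 g eta) => p q d; lra.
  have h1 := second_derivative_lipschitz eta01 c01.
  have h2 : `|xi - c| <= h by rewrite ler_norml; lra.
  rewrite normrM expr2 mulrA; apply: ler_pM => //.
  by apply: (le_trans h1); rewrite ler_wpM2l.
rewrite E normrM (_ : c + h - (c - h) = 2 * h); last by ring.
rewrite (@ger0_norm _ (2 * h)); last by rewrite mulr_ge0 ?ltW.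
have := ler_wpM2r (ltW h0) B.
rewrite (_ : C1 * h ^+ 2 * h = C1 * h ^+ 3); last by ring.
lra.
Qed.

End TimeRegularity.

Lemma low_regularity_bounded_mfun (R : realType) (a b sigma C0 : R) (w : R -> R) :
  a < b -> 0 < sigma -> 0 <= C0 -> class_Cn a b 2 w -> w a = 0 -> w b = 0 ->
  (forall x, a < x < b -> `|w x| <= C0 * ((x - a) * (b - x)) `^ sigma) ->
  bounded_mfun a b w.
Proof.
move=> ab s0 C00 [dw _] wa wb wB; split.
  apply/measurable_fun_itv_bndo_bndcP/measurable_fun_itv_obnd_cbndP.
  apply: open_continuous_measurable_fun => // x; rewrite inE /= in_itv/= => xab.
  apply: differentiable_continuous; apply/derivable1_diffP.
  by have := dw 0%N x isT xab; rewrite derive1n0.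
exists (C0 * ((b - a) * (b - a)) `^ sigma) => y /andP[ay yb].
have m0 : 0 <= C0 * ((b - a) * (b - a)) `^ sigma by rewrite mulr_ge0 ?powR_ge0.
have [->|ya] := eqVneq y a; first by rewrite wa normr0.
have [->|yb'] := eqVneq y b; first by rewrite wb normr0.
have yab : a < y < b by rewrite !lt_neqAle eq_sym ya yb' ay yb.
apply: (le_trans (wB y yab)); rewrite ler_wpM2l//.
by apply: ge0_ler_powR; rewrite ?nnegrE ?mulr_ge0 ?ler_pM//; lra.
Qed.

(** * Residual of the exact solution and the error bound *)

Section ErrorBound.
Context {R : realType}.
Variables (a b alpha r sigma C0 C1 : R).
Variables (f : R -> R -> R) (u0 : R -> R) (u : R -> R -> R).
Hypotheses (ab : a < b) (alpha01 : 0 < alpha < 1) (r0 : 0 < r)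
  (sigma01 : 0 < sigma < 1) (hu : nonlocal_solution a b alpha f u0 u)
  (hspace : low_spatial_regularity a b sigma C0 u)
  (htime : time_regularity a b C1 u).

Let s0 : 0 < sigma. Proof. by case/andP: sigma01. Qed.

Let mid_itv : a < (a + b) / 2 < b. Proof. by move: ab; lra. Qed.

Let C00 : 0 <= C0.
Proof.
have t01 : 0 <= (0 : R) <= 1 by rewrite lexx ler01.
have [_ /(_ 0%N _ isT mid_itv) h] := hspace t01.
have := le_trans (normr_ge0 _) h; rewrite pmulr_lge0//; apply: powR_gt0.
by have /andP[h1 h2] := mid_itv; rewrite mulr_gt0// subr_gt0.
Qed.

Let C10 : 0 <= C1.
Proof.
have t01 : 0 < (2^-1 : R) < 1 by lra.
by have [_ h _] := htime mid_itv t01; exact: le_trans h.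
Qed.

Let u_end t x : 0 <= t -> x = a \/ x = b -> u x t = 0.
Proof.
by move=> t0 xE; apply: (nonlocal_exterior hu) => //; case: xE => ->; rewrite ltxx ?andbF.
Qed.

Let u_bounded_mfun t : 0 <= t <= 1 -> bounded_mfun a b (u^~ t).
Proof.
move=> t01; have [cw wB] := hspace t01; have /andP[t0 _] := t01.
apply: (low_regularity_bounded_mfun (sigma := sigma) ab s0 C00 cw).
- by apply: u_end => //; left.
- by apply: u_end => //; right.
- by move=> x xab; have := wB 0%N x isT xab; rewrite derive1n0 subr0.
Qed.

Section FixedMesh.
Variables (N M : nat) (phi : nat -> R -> R) (K K2 : R).
Hypotheses (N2 : (2 <= N)%N) (M0 : (0 < M)%N)
  (hat : forall j, (j <= N.*2)%N -> is_hat_function a b r N j (phi j)).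
Hypothesis kernel_le : forall x, a <= x <= b ->
  (\int[lebesgue_measure]_(y in `[a, b]) ((`|x - y| `^ alpha)^-1)%:E <= K%:E)%E.

Local Notation x := (graded_mesh a b r N).
Local Notation A := (collocation_mx a b alpha r N phi).
Local Notation W := (end_weight a b (graded_exponent r sigma)
  ((b - a) / 2 * N%:R `^ (- r))).
Local Notation Q := (N%:R ^+ 2 * rate (r * (1 + sigma - alpha)) N).
Hypothesis weight_le : forall z, a <= z <= b ->
  (\int[lebesgue_measure]_(y in `[a, b]) (W y * (`|z - y| `^ alpha)^-1)%:E
    <= (K2 * Q)%:E)%E.

Let N0 : (0 < N)%N. Proof. exact: leq_trans N2. Qed.

Let nodal (t : R) : 'cV[R]_(N.*2.-1) := \col_i u (x i.+1) t.

(** The interpolation error vanishes at the node, so the difference in the integrand reduces to the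
    error at [y], to which the weighted pointwise bound applies. *)
Lemma collocation_consistency t i : 0 <= t <= 1 ->
  `|(A *m nodal t) i 0 - nonlocal_op a b alpha (u^~ t) (x i.+1)| <=
  interpolation_const a b r sigma C0 * K2 * rate (r * (1 + sigma - alpha)) N.
Proof.
move=> t01; have /andP[t0 _] := t01; have [cw wB] := hspace t01.
have xi := node_itv_le ab r0 N0 i.
have bV := hat_sum_bounded_mfun ab r0 N0 hat (nodal t).
have bu := u_bounded_mfun t01.
rewrite (mulmx_collocation ab r0 N0 hat kernel_le) -(nonlocal_opB kernel_le)//.
have Vnode k : (k <= N.*2)%N -> hat_sum phi (nodal t) (x k) = u (x k) t.
  move=> /(nodeP ab r0 N0)[kE|[j ->]]; last by rewrite (hat_sum_node ab r0 N0 hat) mxE.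
  rewrite (hat_sum_end ab r0 N0 hat)// u_end//.
  by case/orP: kE => /eqP ->; [left|right]; rewrite ?graded_mesh0 ?graded_mesh_end.
have err y : a <= y <= b -> `|hat_sum phi (nodal t) y - u y t| <=
    interpolation_const a b r sigma C0 * N%:R ^- 2 * W y.
  move=> yab; rewrite distrC.
  apply: (interpolation_error_le ab r0 sigma01 C00 cw wB _ _ N0 _ Vnode yab).
  - by apply: u_end => //; left.
  - by apply: u_end => //; right.
  - exact: (hat_sum_affine ab r0 N0 hat).
have Ci := interpolation_const_ge0 a b r sigma C00.
have N2R : 0 < N%:R ^+ 2 :> R by rewrite exprn_gt0// ltr0n.
have Ci' : 0 <= interpolation_const a b r sigma C0 * N%:R ^- 2.
  by rewrite mulr_ge0// invr_ge0 ltW.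
have := @nonlocal_op_bound R a b alpha (fun y => hat_sum phi (nodal t) y - u y t)
  (fun y => interpolation_const a b r sigma C0 * N%:R ^- 2 * W y).
move=> H; apply: (H _ _ _ _ _ _).2.
- exact: bounded_mfunB.
- by apply: measurable_funM => //; exact: measurable_end_weight.
- move=> y yab; rewrite (hat_sum_node ab r0 N0 hat) mxE subrr sub0r normrN; exact: err.
under eq_integral do rewrite -mulrA EFinM.
rewrite ge0_integralZl//=; last 2 first.
- apply/measurable_EFinP; apply: measurable_funM; last exact: measurable_riesz.
  exact: measurable_end_weight.
- by move=> y _; rewrite lee_fin mulr_ge0 ?end_weight_ge0 ?invr_ge0 ?powR_ge0.
apply: (@le_trans _ _ ((interpolation_const a b r sigma C0 * N%:R ^- 2)%:E * (K2 * Q)%:E)%E).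
  by rewrite lee_wpmul2l ?lee_fin// weight_le.
rewrite -EFinM lee_fin le_eqVlt; apply/orP; left; apply/eqP.
set I := interpolation_const _ _ _ _ _; set Z := rate _ _.
field; by rewrite gt_eqF// ltr0n.
Qed.

Let tau : R := M%:R^-1.

Let MR : 0 < M%:R :> R. Proof. by rewrite ltr0n. Qed.

Let tau0 : 0 < tau. Proof. by rewrite invr_gt0. Qed.

Let time_itv j : (j <= M)%N -> 0 <= (j%:R / M%:R : R) <= 1.
Proof.
by move=> jM; rewrite divr_ge0//= ler_pdivrMr// mul1r ler_nat.
Qed.

Let half_time j : (1 <= j <= M)%N ->
  let c := (j%:R - 2^-1) * tau in let h := tau / 2 in
  [/\ 0 <= c - h, c + h <= 1, c + h = j%:R / M%:R & c - h = j.-1%:R / M%:R].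
Proof.
move=> /andP[j1 jM] c h.
have E1 : c + h = j%:R / M%:R by rewrite /c /h -/tau; field.
have E2 : c - h = j.-1%:R / M%:R.
  by rewrite -subn1 natrB// /c /h -/tau; field.
split => //; first by rewrite E2 divr_ge0.
by rewrite E1; have /andP[] := time_itv jM.
Qed.

(** The defect of the exact nodal values in the scheme, divided by the time step. *)
Definition residual (j : nat) : 'cV[R]_(N.*2.-1) :=
  M%:R *: (nodal (j%:R / M%:R) - nodal (j.-1%:R / M%:R))
  + 2^-1 *: (A *m nodal (j%:R / M%:R) + A *m nodal (j.-1%:R / M%:R))
  - \col_i f (x i.+1) ((j%:R - 2^-1) * tau).

(** After elimination of [f] by the equation at the midpoint, three errors remain: the central
    difference in time, the average of two spatial consistency errors, and the operator applied to
    the time averaging error [v]. *)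
Lemma residual_le j i : (1 <= j <= M)%N ->
  `|residual j i 0| <=
  interpolation_const a b r sigma C0 * K2 * rate (r * (1 + sigma - alpha)) N
  + (C1 + C1 * K) * M%:R ^- 2.
Proof.
move=> jM; have [ch0 ch1 E1 E2] := half_time jM.
set c := (j%:R - 2^-1) * tau in ch0 ch1 E1 E2 *; set h := tau / 2 in ch0 ch1 E1 E2 *.
have h0 : 0 < h by rewrite divr_gt0.
have hE : M%:R ^- 2 = 4 * h ^+ 2.
  by rewrite /h /tau -exprVn; field; rewrite gt_eqF.
have xi := node_itv ab r0 N0 i; have xi' := node_itv_le ab r0 N0 i.
have c0 : 0 < c by lra.
have tj : 0 <= c + h <= 1 by lra.
have tj' : 0 <= c - h <= 1 by lra.
have tc : 0 <= c <= 1 by lra.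
set X := x i.+1 in xi xi' *.
pose op (w : R -> R) := nonlocal_op a b alpha w X.
have dX y : a < y < b -> forall t, 0 < t -> derivable (u y) t 1.
  by move=> yab t t0; exact: (nonlocal_derivable hu).
have fE : f X c = derive1 (u X) c + op (u^~ c).
  rewrite -(nonlocal_equation hu xi c0); congr (_ + _).
  rewrite -mulN1r -RintegralZl//; last exact: (nonlocal_integrable hu).
  by apply: eq_Rintegral => y _; rewrite /nonlocal_integrand mulrA mulN1r opprB.
have S1 := collocation_consistency i tj; have S2 := collocation_consistency i tj'.
have T1 := midpoint_difference_error (dX X xi) (nonlocal_initial_cvg hu xi)
  (fun t => htime xi) h0 ch0 ch1.
have b1 := u_bounded_mfun tj; have b2 := u_bounded_mfun tj'; have b3 := u_bounded_mfun tc.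
pose v y := 2^-1 * (u y (c + h) + u y (c - h)) - u y c.
have bav : bounded_mfun a b (fun y => 2^-1 * (u y (c + h) + u y (c - h))).
  by apply: bounded_mfunZ; exact: bounded_mfunD.
have opv : op v = (op (u^~ (c + h)) + op (u^~ (c - h))) / 2 - op (u^~ c).
  rewrite /op /v (nonlocal_opB kernel_le)// (nonlocal_opZ kernel_le)//; last exact: bounded_mfunD.
  by rewrite (nonlocal_opD kernel_le)// mulrC.
(* The bound must hold on all of the closed interval, since the operator integrates over it; at the
   endpoints [v] vanishes. *)
have vB y : a <= y <= b -> `|v y| <= C1 * h ^+ 2.
  move=> /andP[ay yb]; have B0 : 0 <= C1 * h ^+ 2 by rewrite mulr_ge0 ?sqr_ge0.
  have [yE|yE] := boolP ((y == a) || (y == b)).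
    have yE' : y = a \/ y = b by case/orP: yE => /eqP ->; [left|right].
    rewrite /v !u_end//; [|lra|lra].
    by rewrite addr0 mulr0 subr0 normr0.
  have yab : a < y < b.
    by move: yE; rewrite negb_or !lt_neqAle ay yb eq_sym !andbT.
  have := midpoint_average_error (dX y yab) (nonlocal_initial_cvg hu yab)
    (fun t => htime yab) h0 ch0 ch1.
  by rewrite /v mulrC.
have T3 : `|op v| <= 2 * (C1 * h ^+ 2) * K.
  by apply: nonlocal_op_le => //; exact: bounded_mfunB.
have -> : residual j i 0 =
    M%:R * (u X (c + h) - u X (c - h) - 2 * h * derive1 (u X) c)
    + ((A *m nodal (c + h)) i 0 - op (u^~ (c + h))
       + ((A *m nodal (c - h)) i 0 - op (u^~ (c - h)))) / 2
    + op v.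
  rewrite /residual -E1 -E2 opv.
  rewrite [LHS]mxE [X in X + _ = _]mxE [X in X + _ + _ = _]mxE
    [X in _ + X + _ = _]mxE [X in _ * X + _ + _ = _]mxE
    [X in _ + _ * X + _ = _]mxE.
  move: ((A *m nodal (c + h)) i 0) ((A *m nodal (c - h)) i 0) => p q.
  rewrite !mxE -/X -/c fE.
  move: (derive1 (u X) c) (op _) (op _) (op _) => g1 g2 g3 g4.
  have -> : 2 * h = tau by rewrite /h; field.
  rewrite /tau; field; by rewrite gt_eqF.
have T1' : `|M%:R * (u X (c + h) - u X (c - h) - 2 * h * derive1 (u X) c)| <= C1 * h ^+ 2.
  rewrite normrM (gtr0_norm MR) (_ : C1 * h ^+ 2 = M%:R * (2 * C1 * h ^+ 3)).
    by rewrite ler_pM2l.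
  by rewrite /h /tau; field; rewrite gt_eqF.
move: T1' T3 S1 S2; rewrite -/X -!/(op _).
set E := M%:R * _; set S := _ - op _; set S' := _ - op _; set O := op v.
move=> hE1 hO hS hS'.
apply: (le_trans (ler_normD _ _)); apply: (le_trans (lerD (ler_normD _ _) (lexx _))).
have hSS : `|(S + S') / 2| <= interpolation_const a b r sigma C0 * K2 * rate (r * (1 + sigma - alpha)) N.
  rewrite normrM normfV (ger0_norm (ler0n R 2)) ler_pdivrMr//.
  by apply: (le_trans (ler_normD _ _)); rewrite mulrDr mulr1 lerD.
have h2 : 0 <= h ^+ 2 by exact: sqr_ge0.
have K0 : 0 <= K by exact: (kernel_bound_ge0 ab kernel_le).
have CK : 0 <= C1 * K * h ^+ 2 by rewrite mulr_ge0// mulr_ge0.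
have Ch : 0 <= C1 * h ^+ 2 by rewrite mulr_ge0.
rewrite hE; move: hSS; set I := _ * rate _ _ => hSS.
rewrite (_ : (C1 + C1 * K) * (4 * h ^+ 2) = 4 * (C1 * h ^+ 2) + 4 * (C1 * K * h ^+ 2)); last by ring.
move: hO; rewrite (_ : 2 * (C1 * h ^+ 2) * K = 2 * (C1 * K * h ^+ 2)); last by ring.
lra.
Qed.

Lemma error_le (U : nat -> 'cV[R]_(N.*2.-1)) (i : 'I_(N.*2.-1)) (j : nat) :
  crank_nicolson a b alpha r f u0 M phi U -> (j <= M)%N ->
  `|u (x i.+1) (j%:R / M%:R) - U j i 0| <=
  expR K * (interpolation_const a b r sigma C0 * `|K2| * rate (r * (1 + sigma - alpha)) N
            + (C1 + C1 * K) * M%:R ^- 2).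
Proof.
move=> [U0 Urec] jM.
have K0 : 0 <= K by exact: (kernel_bound_ge0 ab kernel_le).
have rate0 := rate_ge0 (r * (1 + sigma - alpha)) N0.
have I0 := interpolation_const_ge0 a b r sigma C00.
set rho := _ + _ * M%:R ^- 2.
have rho0 : 0 <= rho.
  apply: addr_ge0; first by rewrite mulr_ge0// mulr_ge0.
  by rewrite mulr_ge0 ?invr_ge0 ?exprn_ge0// addr_ge0// mulr_ge0.
(* Subtracting the scheme from the definition of the residual shows that [e] satisfies the scheme
   with [residual] as source; it starts from 0 because the initial values are exact. *)
pose e j := nodal (j%:R / M%:R) - U j.
have -> : u (x i.+1) (j%:R / M%:R) - U j i 0 = e j i 0 by rewrite !mxE.
apply: (crank_nicolson_stable ab r0 N0 hat kernel_le (res := residual) M0 rho0) => //.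
- apply/matrixP => k l; rewrite /e U0 !mxE mul0r.
  by rewrite (nonlocal_initial hu) ?subrr//; exact: node_itv.
- move=> k kM; rewrite /e !mulmxBr (Urec k kM) /residual.
  rewrite !mulmxDl !mulNmx !mul1mx -!scalemxAl.
  set V := nodal _; set V' := nodal _; set F := \col_i _.
  set AV := A *m V; set AV' := A *m V'; set AU := A *m U _.
  clearbody AV AV' AU F V V'.
  apply/matrixP => p q; rewrite !mxE /tau; field.
  by rewrite gt_eqF.
- move=> k l kM; apply: (le_trans (residual_le l kM)).
  by rewrite lerD2r ler_wpM2r// ler_wpM2l// ler_norm.
Qed.

End FixedMesh.
End ErrorBound.

Theorem theorem5p2 (R : realType) (a b alpha r sigma C0 C1 : R)
    (f : R -> R -> R) (u0 : R -> R) (u : R -> R -> R)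
    (hab : a < b) (halpha : 0 < alpha < 1) (hr : 0 < r)
    (hsigma : 0 < sigma < 1)
    (hu : nonlocal_solution a b alpha f u0 u)
    (hspace : low_spatial_regularity a b sigma C0 u)
    (htime : time_regularity a b C1 u) :
  exists2 C : R, 0 < C &
    forall (N M : nat) (phi : nat -> R -> R) (U : nat -> 'cV[R]_(N.*2.-1)),
      (2 <= N)%N -> (1 <= M)%N ->
      (forall j, (j <= N.*2)%N -> is_hat_function a b r N j (phi j)) ->
      crank_nicolson a b alpha r f u0 M phi U ->
      let p := r * (1 + sigma - alpha) in
      [/\ p < 2 ->
            max_error a b r u M U <= C * (N%:R `^ (- p) + M%:R ^- 2),
          p = 2 ->
            max_error a b r u M U
              <= C * (N%:R `^ (- p) * ln N%:R + M%:R ^- 2)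
        & 2 < p ->
            max_error a b r u M U <= C * (N%:R ^- 2 + M%:R ^- 2)].
Proof.
have [K _ kernel_le] := integral_riesz_le hab halpha.
have [K2 _ weight_le] := integral_end_weight_graded_le hab halpha hr (andP hsigma).1.
set p := r * (1 + sigma - alpha) in weight_le *.
pose A := interpolation_const a b r sigma C0 * `|K2|.
pose B := C1 + C1 * K.
(* The absolute values and the added 1 make [C] positive and larger than both coefficients without
   any sign discussion. *)
pose C := expR K * (`|A| + `|B| + 1).
have C0' : 0 < C by rewrite mulr_gt0 ?expR_gt0// ltr_wpDl// addr_ge0.
exists C => // N M phi U N2 M1 hat cn.
have M0 : 0 <= M%:R ^- 2 :> R by rewrite invr_ge0 exprn_ge0.
have rate0 : 0 <= rate p N by apply: rate_ge0; exact: leq_trans N2.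
have main : max_error a b r u M U <= C * (rate p N + M%:R ^- 2).
  (* The iterated maxima start from 0, so the bound itself has to be nonnegative. *)
  have bound0 : 0 <= C * (rate p N + M%:R ^- 2) by rewrite mulr_ge0 ?(ltW C0')// addr_ge0.
  apply: bigmax_le => // i _; rewrite big_seq; apply: bigmax_le => // k.
  rewrite mem_index_iota ltnS => /andP[_ kM].
  have wN z := weight_le N z N2.
  apply: (le_trans (error_le hab hr hsigma hu hspace htime N2 M1 hat kernel_le wN i cn kM)).
  rewrite /C -(mulrA (expR K)) ler_wpM2l ?expR_ge0// -/p -/A -/B.
  have hA := ler_wpM2r rate0 (ler_norm A); have hB := ler_wpM2r M0 (ler_norm B).
  rewrite mulrDr; apply: lerD.
    by apply: (le_trans hA); rewrite ler_wpM2r// -addrA lerDl addr_ge0.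
  by apply: (le_trans hB); rewrite ler_wpM2r// addrAC lerDr addr_ge0.
rewrite /rate in main; split => [p2|p2|p2]; move: main.
- by rewrite p2.
- by rewrite p2 ltxx eqxx.
- by rewrite ltNge (ltW p2) /= (gt_eqF p2).
Qed.
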